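(* Let $n\to\infty$ and consider the complete graph $K_n$ on vertex set $\{1,\dots,n\}$. To each edge $e$ of $K_n$ assign a length $w(e)$ and a cost $c(e)$, where all the random variables $w(e),c(e)$ ($e\in E(K_n)$) are independent and uniformly distributed on $[0,1]$. Let $\mathcal P$ be the set of paths from vertex $1$ to vertex $2$ in $K_n$, and for $P\in\mathcal P$ let $w(P)=\sum_{e\in P}w(e)$ and $c(P)=\sum_{e\in P}c(e)$. Let $c_0=c_0(n)$ be a budget satisfying \[ \frac{1}{\sqrt 2}\,\frac{\log^2 n}{n}\le c_0\le \frac{1}{2\sqrt 2}. \] Let $L_n=\min\{w(P): P\in\mathcal P,\ c(P)\le c_0\}$ and let $H_n$ be the number of edges of a path attaining this minimum. Then with probability tending to $1$ as $n\to\infty$, \[ L_n\approx \frac{\log^2 n}{4c_0 n}\qquad\text{and}\qquad H_n\approx\frac{\log n}{2}. \]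
   Context: Notation: $A_n\lesssim B_n$ means $A_n\le(1+o(1))B_n$ as $n\to\infty$; $A_n\gtrsim B_n$ means $A_n\ge (1+o(1))B_n$; $A_n\approx B_n$ means both $A_n\lesssim B_n$ and $A_n\gtrsim B_n$. For random quantities, a statement such as ''$L_n\approx B_n$ with probability tending to 1'' means there is a deterministic sequence $\varepsilon_n\to 0$ such that $\mathbb P(|L_n/B_n-1|\le \varepsilon_n)\to 1$. $\log$ is the natural logarithm. *)

(* Defs.v *)
From HB Require Import structures.
From mathcomp Require Import all_boot all_order all_algebra.
From mathcomp Require Import all_classical all_reals all_analysis.

Set Implicit Arguments.
Unset Strict Implicit.
Unset Printing Implicit Defensive.

Import Order.TTheory GRing.Theory Num.Theory.
Import numFieldNormedType.Exports.

Local Open Scope classical_set_scope.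
Local Open Scope ring_scope.

Definition mutually_independent d (T : measurableType d) (R : realType)
    (P : probability T R) (I : finType) (X : I -> {RV P >-> R}) : Prop :=
  forall (J : {set I}) (B : I -> set R),
    (forall i, i \in J -> measurable (B i)) ->
    P (\bigcap_(i in [set` J]) (X i @^-1` B i)) =
    (\prod_(i in J) P (X i @^-1` B i))%E.

Definition uniform01 d (T : measurableType d) (R : realType)
    (P : probability T R) (X : {RV P >-> R}) : Prop :=
  forall A : set R, measurable A ->
    distribution P X A = uniform_prob (@ltr01 R) A.

(* The vertex labelled k (1 <= k <= n) of K_n is the ordinal of value k - 1. *)
Definition edge (n : nat) := {e : {set 'I_n} | #|e| == 2%N}.

Definition join_edges d (T : measurableType d) (R : realType)
    (P : probability T R) (n : nat) (w c : edge n -> {RV P >-> R})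
    (i : edge n + edge n) : {RV P >-> R} :=
  match i with inl e => w e | inr e => c e end.

Section Paths.
Variable n : nat.

(* A path is the sequence of its vertices; as these are distinct there are at
   most n of them, which makes the type of paths finite. *)
Definition path12 (p : {bseq n of 'I_n}) : bool :=
  uniq p &&
  (if bseqval p is x :: s
   then (val x == 0%N) && (val (last x s) == 1%N) else false).

Definition path_edges (p : {bseq n of 'I_n}) : {set edge n} :=
  [set e | val e \in
     (if bseqval p is x :: s
      then pairmap (fun u v : 'I_n => [set u; v]%SET) x s else [::])]%SET.

Variable R : realType.

Definition weight (w : edge n -> R) (p : {bseq n of 'I_n}) : R :=
  \sum_(e in path_edges p) w e.

Definition feasible (c : edge n -> R) (c0 : R) (p : {bseq n of 'I_n}) : bool :=
  path12 p && (weight c p <= c0).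

(* The minimum over the empty set is +oo. *)
Definition min_length (w c : edge n -> R) (c0 : R) : \bar R :=
  \big[Order.min/+oo%E]_(p : {bseq n of 'I_n} | feasible c c0 p)
    (weight w p)%:E.

Definition optimal (w c : edge n -> R) (c0 : R) (p : {bseq n of 'I_n}) : bool :=
  feasible c c0 p && ((weight w p)%:E == min_length w c c0).

End Paths.

Definition rel_close (R : realType) (eps : R) (x : \bar R) (b : R) : Prop :=
  (`| x * (b^-1)%:E - 1 | <= eps%:E)%E.

(* Main.v *)
(* A path with k edges has length at most L and cost at most C with probability
   (L C)^k / k!^2, so the expected number of such paths is about
   (n L C)^k / (n k!^2). This is largest at k = sqrt (n L C), where it is roughly
   exp (2 sqrt (n L C)) / n, and it crosses 1 at n L C = (ln n)^2 / 4, with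
   k = ln n / 2. The first moment rules out shorter paths and paths whose number
   of edges is far from ln n / 2.

   For existence, take k = floor (ln n / 2) and allow a factor 1 + eps in L. Given
   one good path, the conditional probability of another one is multiplied by at
   most k^2 / (L C) <= rho n for each shared edge, with rho < 1, while sharing an
   edge costs a factor n in the number of paths: the overlaps form a geometric
   series. To make the second moment asymptotic to the square of the first, rather
   than only comparable to it, the edges at the vertices 1 and 2 receive a budget
   of their own, of order delta L and delta C; there are then about
   (delta ln n / 2)^2, hence unboundedly many, usable edges at either end.

   All probabilities are computed on the uniform space of integer parts of M w(e)
   and M c(e), where M is a huge integer depending on n: there the volumes of
   simplices become binomial coefficients and independence becomes counting. *)

Require Import Defs.
From HB Require Import structures.
From mathcomp Require Import all_boot all_order all_algebra.
From mathcomp Require Import all_classical all_reals all_analysis.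
From mathcomp Require Import measurable_realfun ring lra zify.
Import Order.TTheory GRing.Theory Num.Theory.
Import numFieldNormedType.Exports.

Set Implicit Arguments.
Unset Strict Implicit.
Unset Printing Implicit Defensive.

Local Open Scope ring_scope.

(** * Uniform product spaces *)

Section UniformSpace.
Variables (R : realFieldType) (I : finType) (m : nat).
Local Notation M := (m.+1%:R : R).
Local Notation Omega := {ffun I -> 'I_m.+1}.

Definition Ex (f : Omega -> R) : R := (\sum_a f a) / M ^+ #|I|.

Definition depends_on (D : {set I}) (U : Type) (f : Omega -> U) :=
  forall a b : Omega, (forall i, i \in D -> a i = b i) -> f a = f b.

Lemma M_gt0 : 0 < M.
Proof. by rewrite ltr0n. Qed.

Lemma Mpow_gt0 k : 0 < M ^+ k.
Proof. by rewrite exprn_gt0 // M_gt0. Qed.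

Lemma card_Omega : (#|{: Omega}|%:R : R) = M ^+ #|I|.
Proof. by rewrite card_ffun card_ord natrX. Qed.

Lemma Ex_cst (x : R) : Ex (fun=> x) = x.
Proof.
rewrite /Ex sumr_const -(mulr_natr x) card_Omega.
by rewrite mulfK // gt_eqF // Mpow_gt0.
Qed.

Lemma eq_Ex (f g : Omega -> R) : f =1 g -> Ex f = Ex g.
Proof. by move=> fg; rewrite /Ex (eq_bigr g). Qed.

Lemma le_Ex (f g : Omega -> R) : (forall a, f a <= g a) -> Ex f <= Ex g.
Proof.
by move=> fg; rewrite /Ex ler_pM2r ?invr_gt0 ?Mpow_gt0 // ler_sum.
Qed.

Lemma Ex_sum (J : Type) (s : seq J) (Q : pred J) (f : J -> Omega -> R) :
  Ex (fun a => \sum_(j <- s | Q j) f j a) = \sum_(j <- s | Q j) Ex (f j).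
Proof. by rewrite /Ex exchange_big /= mulr_suml. Qed.

Lemma ExZ (x : R) f : Ex (fun a => x * f a) = x * Ex f.
Proof. by rewrite /Ex -mulr_sumr mulrA. Qed.

Lemma ExD f g : Ex (fun a => f a + g a) = Ex f + Ex g.
Proof. by rewrite /Ex big_split /= mulrDl. Qed.

(* Swapping the coordinates of two samples on D is an involution of the square
   of the sample space. *)
Lemma Ex_indep (D : {set I}) f g :
  depends_on D f -> depends_on (~: D) g ->
  Ex (fun a => f a * g a) = Ex f * Ex g.
Proof.
move=> fD gD.
pose mix (a b : Omega) : Omega := [ffun i => if i \in D then a i else b i].
pose sw (u : Omega * Omega) := (mix u.1 u.2, mix u.2 u.1).
have swK : involutive sw.
  move=> [a b]; rewrite /sw /=; congr (_, _); apply/ffunP => i;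
  by rewrite !ffunE; case: (i \in D).
have eqfg : (\sum_a f a) * (\sum_a g a) =
    \sum_(u : Omega * Omega) f (mix u.1 u.2) * g (mix u.1 u.2).
  transitivity (\sum_(u : Omega * Omega) f u.1 * g u.2).
    rewrite -(pair_bigA _ (fun a b => f a * g b)) /= mulr_suml.
    by apply: eq_bigr => a _; rewrite mulr_sumr.
  apply: eq_bigr => -[a b] _ /=; congr (_ * _).
    by apply: fD => i iD; rewrite ffunE iD.
  by apply: gD => i; rewrite inE => /negPf iD; rewrite ffunE iD.
have {}eqfg : (\sum_a f a) * (\sum_a g a) =
    (\sum_a f a * g a) * M ^+ #|I|.
  rewrite eqfg (reindex_inj (inv_inj swK)) /=.
  transitivity (\sum_(u : Omega * Omega) f u.1 * g u.1).
    apply: eq_bigr => -[a b] _ /=.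
    suff -> : mix (mix a b) (mix b a) = a by [].
    by apply/ffunP => i; rewrite !ffunE; case: (i \in D).
  rewrite -(pair_bigA _ (fun a b => f a * g a)) /= mulr_suml.
  by apply: eq_bigr => a _; rewrite sumr_const card_ffun card_ord -natrX mulr_natr.
rewrite /Ex mulrACA eqfg -mulrA; congr (_ * _).
by rewrite mulrA divff ?mul1r // gt_eqF // Mpow_gt0.
Qed.

Lemma Ex_coord (i : I) (j : 'I_m.+1) : Ex (fun a => (a i == j)%:R) = M^-1.
Proof.
pose F i' (j' : 'I_m.+1) : R := if i' == i then (j' == j)%:R else 1.
have -> : Ex (fun a => (a i == j)%:R) = (\sum_(a : Omega) \prod_i' F i' (a i')) / M ^+ #|I|.
  congr (_ / _); apply: eq_bigr => a _.
  rewrite (bigD1 i) //= /F eqxx big1 ?mulr1 // => i' /negPf -> //.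
rewrite -bigA_distr_bigA (bigD1 i) //= {1}/F eqxx (bigD1 j) //= eqxx.
rewrite big1 ?addr0 ?mul1r => [|j' /negPf -> //].
rewrite (eq_bigr (fun=> M)) => [|i' /negPf ni]; last first.
  by rewrite /F ni sumr_const card_ord.
have cI : #|(fun i' => i' != i)| = #|I|.-1.
  by rewrite -(cardC1 i); apply: eq_card.
rewrite prodr_const cI.
have : (0 < #|I|)%N by apply/card_gt0P; exists i.
case: #|I| => // n _ /=; by rewrite exprS invfM mulrCA divff ?mulr1.
Qed.

(* The probability that k independent coordinates have sum at most s, provided
   s <= m; an upper bound for it otherwise. *)
Definition simplex_prob (k s : nat) : R := 'C(s + k, k)%:R / M ^+ k.

Definition sum_le (S : {set I}) (s : nat) (a : Omega) : bool :=
  (\sum_(i in S) a i <= s)%N.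

Lemma sum_le_depends S s (U : Type) (h : bool -> U) : depends_on S (fun a => h (sum_le S s a)).
Proof.
move=> a b ab; rewrite /sum_le; congr (h (_ <= _)%N).
by apply: eq_bigr => i /ab ->.
Qed.

Lemma sum_le_natr_depends S s : depends_on S (fun a => (sum_le S s a)%:R : R).
Proof. exact: (@sum_le_depends S s R (fun b => b%:R)). Qed.

Lemma hockey_stick k s :
  (\sum_(j < s.+1) 'C(s - j + k, k) = 'C(s + k.+1, k.+1))%N.
Proof.
elim: s => [|s IHs].
  by rewrite big_ord1 add0n binn add0n binn.
rewrite big_ord_recl subn0 /= (eq_bigr (fun j : 'I_s.+1 => 'C(s - j + k, k))%N) => [|j _].
  by rewrite IHs [in RHS]addSn binS addnC addSnnS.
by rewrite /bump /= add1n subSS.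
Qed.

Lemma sum_le_setU1 (i : I) (S : {set I}) s (a : Omega) : i \notin S ->
  (sum_le (i |: S) s a)%:R =
  \sum_(j < m.+1) (a i == j)%:R * ((j <= s)%N && sum_le S (s - j) a)%:R :> R.
Proof.
move=> iS; rewrite (bigD1 (a i)) //= eqxx mul1r big1 ?addr0 => [|j ja]; last first.
  by rewrite eq_sym (negPf ja) mul0r.
congr (_%:R); congr nat_of_bool; rewrite /sum_le big_setU1 //=.
by apply/idP/andP => [h|[h1 h2]]; first split; lia.
Qed.

Lemma Ex_sum_leS (i : I) (S : {set I}) s : i \notin S ->
  Ex (fun a => (sum_le (i |: S) s a)%:R) =
  M^-1 * \sum_(j < m.+1 | (j <= s)%N) Ex (fun a => (sum_le S (s - j) a)%:R).
Proof.
move=> iS.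
rewrite (eq_Ex (fun a => sum_le_setU1 s a iS)) Ex_sum mulr_sumr [RHS]big_mkcond /=.
apply: eq_bigr => j _; rewrite (@Ex_indep [set i]).
- rewrite Ex_coord; case: ifP => js //=.
  by rewrite Ex_cst mulr0.
- by move=> a b ab; rewrite ab // inE.
- move=> a b ab; congr (_ && _)%:R; apply: (@sum_le_depends S _ _ id) => i' i'S.
  by apply: ab; rewrite !inE; apply: contraNneq iS => <-.
Qed.

Lemma simplex_probS k s :
  simplex_prob k.+1 s = M^-1 * \sum_(j < s.+1) simplex_prob k (s - j).
Proof.
rewrite /simplex_prob -hockey_stick natr_sum exprS invfM -mulr_suml; ring.
Qed.

Lemma simplex_prob_ge0 k s : 0 <= simplex_prob k s.
Proof. by rewrite divr_ge0 // ltW // Mpow_gt0. Qed.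

Lemma sum_ord_le_le (s : nat) (F : nat -> R) : (forall j, 0 <= F j) ->
  \sum_(j < m.+1 | (j <= s)%N) F j <= \sum_(j < s.+1) F j.
Proof.
move=> F0; rewrite -(big_mkord (fun j => (j <= s)%N)) -(big_mkord xpredT).
case: (leqP m s) => ms.
  rewrite [leRHS](big_cat_nat (n := m.+1)) //= -[leLHS]addr0.
  apply: lerD; last by apply: sumr_ge0.
  by rewrite big_mkcond; apply: ler_sum => j _; case: ifP.
rewrite [leLHS](big_cat_nat (n := s.+1)) ?(leqW ms) //=.
rewrite [X in _ + X]big1_seq ?addr0.
  by rewrite big_mkcond; apply: ler_sum => j _; case: ifP.
by move=> j; rewrite mem_index_iota; lia.
Qed.

Lemma sum_ord_le_eq (s : nat) (F : nat -> R) : (s <= m)%N ->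
  \sum_(j < m.+1 | (j <= s)%N) F j = \sum_(j < s.+1) F j.
Proof.
move=> sm; rewrite (big_ord_widen _ _ (_ : (s.+1 <= m.+1)%N)) //.
Qed.

Lemma Ex_sum_le_le S s : Ex (fun a => (sum_le S s a)%:R) <= simplex_prob #|S| s.
Proof.
elim: {S}_.+1 {-2}S (ltnSn #|S|) s => // n IHn S Sn s.
have [->|[i iS]] := set_0Vmem S.
  rewrite cards0 /simplex_prob bin0 expr0 divr1.
  rewrite (@eq_Ex _ (fun=> 1)) ?Ex_cst // => a.
  by rewrite /sum_le big_set0.
have SE := finset.setD1K iS; have iS' : i \notin S :\ i by rewrite !inE eqxx.
have cS : #|S| = #|S :\ i|.+1 by rewrite (cardsD1 i) iS.
rewrite -{1}SE Ex_sum_leS // cS simplex_probS.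
rewrite ler_pM2l ?invr_gt0 ?M_gt0 //.
apply: le_trans (@sum_ord_le_le s (fun j => simplex_prob #|S :\ i| (s - j)) _);
  last by move=> j; exact: simplex_prob_ge0.
apply: ler_sum => j _; apply: IHn; lia.
Qed.

Lemma Ex_sum_le_eq S s : (s <= m)%N ->
  Ex (fun a => (sum_le S s a)%:R) = simplex_prob #|S| s.
Proof.
elim: {S}_.+1 {-2}S (ltnSn #|S|) s => // n IHn S Sn s sm.
have [->|[i iS]] := set_0Vmem S.
  rewrite cards0 /simplex_prob bin0 expr0 divr1.
  rewrite (@eq_Ex _ (fun=> 1)) ?Ex_cst // => a.
  by rewrite /sum_le big_set0.
have SE := finset.setD1K iS; have iS' : i \notin S :\ i by rewrite !inE eqxx.
have cS : #|S| = #|S :\ i|.+1 by rewrite (cardsD1 i) iS.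
rewrite -{1}SE Ex_sum_leS // cS simplex_probS.
rewrite -(@sum_ord_le_eq s (fun j => simplex_prob #|S :\ i| (s - j))) //.
congr (_ * _); apply: eq_bigr => j _; apply: IHn; lia.
Qed.


Lemma depends_onS (D D' : {set I}) (U : Type) (f : Omega -> U) :
  D \subset D' -> depends_on D f -> depends_on D' f.
Proof. by move=> /fintype.subsetP sD fD a b ab; apply: fD => i /sD; exact: ab. Qed.

Lemma depends_on_mul (D : {set I}) (f g : Omega -> R) :
  depends_on D f -> depends_on D g -> depends_on D (fun a => f a * g a).
Proof. by move=> fD gD a b ab; rewrite (fD a b) ?(gD a b). Qed.

End UniformSpace.

Section Budget.
Variables (R : realFieldType) (E : finType) (m : nat).
Local Notation Omega := {ffun E + E -> 'I_m.+1}.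
Implicit Types (S : {set E}) (s t : nat) (a : Omega).

Definition budget S s t a : bool :=
  (\sum_(e in S) a (inl e) <= s)%N && (\sum_(e in S) a (inr e) <= t)%N.

Definition coords S : {set E + E} :=
  [set i | match i with inl e | inr e => e \in S end].

Lemma budgetE S s t a : budget S s t a =
  sum_le (inl @: S) s a && sum_le (inr @: S) t a.
Proof.
by rewrite /budget /sum_le !big_imset //= => ? ? _ _ [].
Qed.

Lemma inl_coords S : inl @: S \subset coords S.
Proof. by apply/fintype.subsetP => _ /imsetP[e eS ->]; rewrite inE. Qed.

Lemma inr_coords S : inr @: S \subset coords S.
Proof. by apply/fintype.subsetP => _ /imsetP[e eS ->]; rewrite inE. Qed.

Lemma budget_depends S s t (U : Type) (h : bool -> U) :
  depends_on (coords S) (fun a => h (budget S s t a)).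
Proof.
move=> a b ab; rewrite /budget.
by congr (h ((_ <= _)%N && (_ <= _)%N)); apply: eq_bigr => e eS;
  rewrite ab // inE.
Qed.

Lemma budget_natr_depends S s t :
  depends_on (coords S) (fun a => (budget S s t a)%:R : R).
Proof. exact: (@budget_depends S s t R (fun b => b%:R)). Qed.

Lemma budgetS S S' s t a : S' \subset S -> budget S s t a -> budget S' s t a.
Proof.
move=> sS /andP[h1 h2]; apply/andP; split.
  by apply: leq_trans h1; rewrite [leqRHS](big_setID S') /= (finset.setIidPr sS) leq_addr.
by apply: leq_trans h2; rewrite [leqRHS](big_setID S') /= (finset.setIidPr sS) leq_addr.
Qed.

Lemma coordsC S S' : [disjoint S & S'] -> coords S \subset ~: coords S'.
Proof.
move=> /pred0P d; apply/fintype.subsetP => -[e|e]; rewrite !inE => eS; apply/negP => eS';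
by have := d e; rewrite /= eS eS'.
Qed.

Lemma Ex_budget_mul S s t (g : Omega -> R) : (s <= m)%N -> (t <= m)%N ->
  depends_on (~: coords S) g ->
  Ex (fun a => (budget S s t a)%:R * g a) =
  simplex_prob R m #|S| s * simplex_prob R m #|S| t * Ex g.
Proof.
move=> sm tm gS.
rewrite (@eq_Ex _ _ _ _ (fun a => (sum_le (inl @: S) s a)%:R *
   ((sum_le (inr @: S) t a)%:R * g a))) => [|a]; last first.
  by rewrite budgetE; case: sum_le; case: sum_le; rewrite /= ?(mul1r, mul0r).
have iln : [disjoint inl @: S & inr @: S].
  by apply/pred0P => i /=; apply/negP => /andP[/imsetP[? _ ->] /imsetP[? _]].
rewrite (@Ex_indep _ _ _ (inl @: S)); first last.
- apply: depends_on_mul.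
    apply: (@depends_onS _ _ (inr @: S)); last exact: sum_le_natr_depends.
    by rewrite -finset.disjoints_subset disjoint_sym.
  by apply: depends_onS gS; rewrite finset.setCS inl_coords.
- exact: sum_le_natr_depends.
rewrite (@Ex_indep _ _ _ (inr @: S)); first last.
- by apply: depends_onS gS; rewrite finset.setCS inr_coords.
- exact: sum_le_natr_depends.
rewrite !Ex_sum_le_eq // !card_imset ?mulrA //; by move=> ? ? [].
Qed.

Lemma Ex_budget_le S s t : Ex (fun a => (budget S s t a)%:R) <=
  simplex_prob R m #|S| s * simplex_prob R m #|S| t.
Proof.
rewrite (@eq_Ex _ _ _ _ (fun a => (sum_le (inl @: S) s a)%:R *
   (sum_le (inr @: S) t a)%:R)) => [|a]; last first.
  by rewrite budgetE; case: sum_le; case: sum_le; rewrite /= ?(mul1r, mul0r).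
have iln : [disjoint inl @: S & inr @: S].
  by apply/pred0P => i /=; apply/negP => /andP[/imsetP[? _ ->] /imsetP[? _]].
rewrite (@Ex_indep _ _ _ (inl @: S)); first last.
- apply: (@depends_onS _ _ (inr @: S)); last exact: sum_le_natr_depends.
  by rewrite -finset.disjoints_subset disjoint_sym.
- exact: sum_le_natr_depends.
apply: ler_pM; try by rewrite -[leLHS](@Ex_cst R (E + E)%type m); apply: le_Ex.
  by rewrite (le_trans (Ex_sum_le_le _ _ _ _)) // card_imset // => ? ? [].
by rewrite (le_trans (Ex_sum_le_le _ _ _ _)) // card_imset // => ? ? [].
Qed.

End Budget.

(** * Overlaps with a fixed path *)

Lemma sum_tuple_cons (R : nmodType) (V : finType) (r : nat) (Q : pred (seq V))
    (F : seq V -> R) :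
  \sum_(s : r.+1.-tuple V | Q s) F s =
  \sum_x \sum_(s : r.-tuple V | Q (x :: s)) F (x :: s).
Proof.
rewrite pair_big_dep /=.
rewrite (reindex (fun u : V * r.-tuple V => [tuple of u.1 :: u.2])) //=.
exists (fun t : r.+1.-tuple V => (thead t, [tuple of behead t])) => [[x s] _|t _] /=.
  by congr (_, _); apply: val_inj.
by rewrite -tuple_eta.
Qed.

Section Overlap.
Variables (R : realFieldType) (V : finType) (p : seq V) (theta : R).

Definition adj (x y : V) : bool :=
  [&& x \in p, y \in p &
      (index y p == (index x p).+1) || (index x p == (index y p).+1)].

Definition step (x y : V) : R := if adj x y then theta else 1.

Fixpoint walk_wt (x : V) (s : seq V) : R :=
  if s is y :: s' then step x y * walk_wt y s' else 1.

Definition path_wt (s : seq V) : R :=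
  if s is x :: s' then walk_wt x s' else 1.

Lemma adjC x y : adj x y = adj y x.
Proof. by rewrite /adj andbCA orbC. Qed.

Lemma stepC x y : step x y = step y x.
Proof. by rewrite /step adjC. Qed.

Lemma walk_wt_rcons x s y :
  walk_wt x (rcons s y) = walk_wt x s * step (last x s) y.
Proof.
elim: s x => [|z s IHs] x /=; first by rewrite mulr1 mul1r.
by rewrite IHs mulrA.
Qed.

Lemma path_wt_rev s : path_wt (rev s) = path_wt s.
Proof.
elim: s => // x [|y s] //= IHs.
rewrite rev_cons; move: IHs; rewrite /path_wt /=.
rewrite -/(walk_wt y s) stepC => <-.
rewrite rev_cons; case: (rev s) => [|z s'] /=; first by [].
by rewrite walk_wt_rcons last_rcons mulrC.
Qed.

Definition deg (A : seq V) (x : V) : nat := #|[set y | adj x y && (y \notin A)]|.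

Definition nbr_set (x : V) : {set V} :=
  [set nth x p (index x p).+1; nth x p (index x p).-1].

Lemma adj_nbr_set x y : adj x y -> y \in nbr_set x.
Proof.
move=> /and3P[xp yp /orP[/eqP e|/eqP e]]; rewrite !inE.
  by rewrite -e nth_index ?eqxx.
by rewrite e /= nth_index ?eqxx ?orbT.
Qed.

Lemma deg_notin A x : x \notin p -> deg A x = 0%N.
Proof.
move=> xp; apply/eqP; rewrite cards_eq0; apply/eqP/setP => y.
by rewrite !inE /adj (negPf xp).
Qed.

Lemma deg_le2 A x : (deg A x <= 2)%N.
Proof.
apply: (@leq_trans #|nbr_set x|); last by rewrite cards2; case: eqP.
by apply/subset_leq_card/fintype.subsetP => y; rewrite inE => /andP[/adj_nbr_set].
Qed.

Lemma deg_visited A x y : adj x y -> (deg (y :: A) x <= 1)%N.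
Proof.
move=> /adj_nbr_set yx; rewrite -ltnS.
apply: (@leq_trans #|nbr_set x|); last by rewrite cards2; case: eqP.
rewrite (cardsD1 y) yx add1n ltnS.
apply/subset_leq_card/fintype.subsetP => z; rewrite !inE negb_or.
by move=> /and3P[/adj_nbr_set + -> _]; rewrite !inE.
Qed.


Hypothesis p_uniq : uniq p.
Lemma deg_last A x0 : (deg A (last x0 p) <= 1)%N.
Proof.
rewrite -(cards1 (nth x0 p (index (last x0 p) p).-1)).
apply/subset_leq_card/fintype.subsetP => y; rewrite !inE => /andP[/and3P[lp yp] + _].
have -> : index (last x0 p) p = (size p).-1.
  by rewrite -nth_last index_uniq //; case: (p) lp.
case/orP => /eqP e; last by rewrite e /= nth_index.
by move: yp; rewrite -index_mem e; case: (p) lp => //= a l _; rewrite ltnn.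
Qed.

Variables (rho K mu theta1 : R).
Hypotheses (rho0 : 0 <= rho) (K0 : 0 <= K) (rhoK : 1 + rho * K <= K).
Hypotheses (theta0 : 0 <= theta) (theta_le : theta <= rho * #|V|%:R).
Hypotheses (mu0 : 0 <= mu) (theta1_ge : 0 <= theta1) (theta1_le : theta1 <= mu * #|V|%:R).

Definition growth : R := #|V|%:R + 2 * K * (size p)%:R.
Local Notation B := growth.

Lemma card_le_growth : #|V|%:R <= B.
Proof. by rewrite lerDl !mulr_ge0. Qed.

Lemma growth_ge0 : 0 <= B.
Proof. exact: le_trans (ler0n _ _) card_le_growth. Qed.

Lemma step_ge0 x y : 0 <= step x y.
Proof. by rewrite /step; case: ifP. Qed.

Lemma walk_wt_ge0 x s : 0 <= walk_wt x s.
Proof. by elim: s x => //= y s IHs x; rewrite mulr_ge0 // step_ge0. Qed.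

Lemma path_wt_ge0 s : 0 <= path_wt s.
Proof. by case: s => //= x s; exact: walk_wt_ge0. Qed.

Definition walk_sum (r : nat) (A : seq V) (x : V) : R :=
  \sum_(s : r.-tuple V | uniq (x :: s) && all (fun y => y \notin A) s) walk_wt x s.

Lemma walk_sumS r A x : walk_sum r.+1 A x <=
  \sum_(y | y \notin A) step x y * walk_sum r (x :: A) y.
Proof.
rewrite /walk_sum.
rewrite (@sum_tuple_cons _ _ _ (fun s => uniq (x :: s) && all (fun y => y \notin A) s) (walk_wt x)).
rewrite [leRHS]big_mkcond; apply: ler_sum => y _ /=.
case: ifP => yA; last by rewrite big1 // => s; rewrite andbF.
rewrite mulr_sumr big_mkcond [leRHS]big_mkcond; apply: ler_sum => s _ /=.
case: ifP => [/andP[/andP[+ /andP[ys us]] sA]|_]; last first.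
  by case: ifP => // _; rewrite mulr_ge0 ?step_ge0 ?walk_wt_ge0.
rewrite inE negb_or => /andP[xy xs].
rewrite ys us /= ifT //; apply/allP => z zs.
rewrite inE negb_or (allP sA) // andbT.
by apply: contraNneq xs => <-.
Qed.

Lemma sum_deg A x (c : R) :
  \sum_(y | y \notin A) (if adj x y then c else 0) = (deg A x)%:R * c.
Proof.
rewrite /deg -sum1_card natr_sum mulr_suml -big_mkcondr big_mkcond [RHS]big_mkcond.
by apply: eq_bigr => y _; rewrite inE andbC mul1r.
Qed.

Lemma sum_mem_p (c : R) : \sum_(y : V) (y \in p)%:R * c = (size p)%:R * c.
Proof.
rewrite -mulr_suml; congr (_ * c).
rewrite -natr_sum; congr (_%:R).
by rewrite -(card_uniqP p_uniq) -sum1_card [RHS]big_mkcond; apply: eq_bigr => y _; case: (y \in p).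
Qed.

(* Off the path a step has at most #|V| continuations of weight 1, and each of
   the (at most two) continuations along the path contributes a geometric
   series of ratio rho. *)
Lemma walk_sum_le r A x :
  walk_sum r A x <= (1 + (deg A x)%:R * (rho * K)) * B ^+ r.
Proof.
have rK0 : 0 <= rho * K by rewrite mulr_ge0.
elim: r A x => [|r IHr] A x.
  apply: (@le_trans _ _ (\sum_(s : 0.-tuple V) 1)).
    by rewrite /walk_sum big_mkcond; apply: ler_sum => -[[|? ?] //= ?] _; case: ifP.
  rewrite sumr_const card_tuple expn0.
  by rewrite expr0 mulr1 lerDl mulr_ge0.
apply: le_trans (walk_sumS _ _ _) _.
pose f y := (if adj x y then theta * K else 0) + (1 + (y \in p)%:R * (2 * (rho * K))).
apply: (@le_trans _ _ (\sum_(y | y \notin A) f y * B ^+ r)).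
  apply: ler_sum => y yA; rewrite /step /f; have Br : 0 <= B ^+ r by rewrite exprn_ge0 // growth_ge0.
  case: ifP => xy.
    have {}IHr : walk_sum r (x :: A) y <= K * B ^+ r.
      apply: le_trans (IHr _ _) _; rewrite ler_wpM2r //.
      apply: le_trans rhoK; rewrite lerD2l ler_piMl //.
      by rewrite lern1 deg_visited // adjC.
    apply: le_trans (ler_wpM2l theta0 IHr) _; rewrite [leLHS]mulrA ler_wpM2r //.
    by rewrite lerDl addr_ge0 // mulr_ge0 // mulr_ge0.
  rewrite mul1r add0r; apply: le_trans (IHr _ _) _; rewrite ler_wpM2r // lerD2l.
  case: (boolP (y \in p)) => yp; last by rewrite deg_notin // !mul0r.
  by rewrite mul1r ler_wpM2r // ler_nat deg_le2.
rewrite -mulr_suml exprS mulrA ler_wpM2r ?exprn_ge0 ?growth_ge0 //.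
rewrite big_split /= sum_deg.
apply: (@le_trans _ _ ((deg A x)%:R * (theta * K) + B)).
  rewrite lerD2l.
  apply: (@le_trans _ _ (\sum_(y : V) (1 + (y \in p)%:R * (2 * (rho * K))))).
    by rewrite big_mkcond; apply: ler_sum => y _; case: ifP => // _;
      rewrite addr_ge0 // mulr_ge0 // mulr_ge0.
  rewrite big_split /= sumr_const sum_mem_p /growth lerD2l.
  rewrite mulrC ler_wpM2r // ler_wpM2l // -[leRHS]mul1r.
  by rewrite mul1r (le_trans _ rhoK) // lerDr.
rewrite mulrDl mul1r addrC lerD2l -!mulrA ler_wpM2l //.
have h := card_le_growth.
rewrite [leRHS](_ : _ = (rho * B) * K); last by ring.
rewrite ler_wpM2r // (le_trans theta_le) // ler_wpM2l //.
Qed.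


Lemma index_mid p1 z p2 : rcons p1 z ++ p2 = p -> index z p = size p1.
Proof.
move=> pE; have := p_uniq; rewrite -pE cat_rcons cat_uniq /= negb_or.
move=> /and3P[_ /andP[zp1 _] _].
by rewrite index_cat (negPf zp1) /= eqxx addn0.
Qed.

Lemma adj_next p1 z y p2 : rcons p1 z ++ y :: p2 = p -> adj z y.
Proof.
move=> pE; have pE' : rcons (rcons p1 z) y ++ p2 = p by rewrite cat_rcons.
rewrite /adj (index_mid pE) (index_mid pE') size_rcons eqxx.
by rewrite -pE !mem_cat mem_rcons !inE !eqxx /= orbT.
Qed.

Lemma adj_fresh p1 z x y p2 : rcons p1 z ++ y :: p2 = p ->
  x \notin rcons p1 z -> x != y -> adj z x = false.
Proof.
move=> pE xp xy; apply/negP => /and3P[_ xinp]; rewrite (index_mid pE).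
case/orP => /eqP e.
  move/eqP: xy; apply; rewrite -(nth_index x xinp) e -pE.
  by rewrite nth_cat size_rcons ltnn subnn.
move/negP: xp; apply; rewrite -(nth_index x xinp) -pE nth_cat size_rcons pE e.
by rewrite leqW ?leqnn // mem_nth // size_rcons e leqW.
Qed.

(* A path shares the edge at an end vertex of K_n with p exactly when it has the
   same extremity as p there; theta1 is the weight of such an edge. *)
Definition end_wt (l : V) (s : seq V) : R :=
  if s is x :: s' then (if last x s' == l then theta1 else 1) else 1.

Lemma if_wt_ge0 (b : bool) : 0 <= (if b then theta1 else 1).
Proof. by case: b. Qed.

Lemma end_wt_ge0 l s : 0 <= end_wt l s.
Proof. by case: s => //= x s; case: ifP. Qed.

Lemma end_wt_rev l x s : end_wt l (rev (x :: s)) = if x == l then theta1 else 1.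
Proof.
rewrite rev_cons /end_wt; case: (rev s) => //= y s'.
by rewrite last_rcons.
Qed.

Lemma end_sum_le r x0 :
  \sum_(s : r.+1.-tuple V | uniq s) path_wt s * end_wt (last x0 p) s <=
  (1 + mu * K) * growth ^+ r.+1.
Proof.
have rK0 : 0 <= rho * K by rewrite mulr_ge0.
have Br : 0 <= B ^+ r by rewrite exprn_ge0 // growth_ge0.
set l := last x0 p.
pose rv (s : r.+1.-tuple V) := [tuple of rev s].
have rvK : involutive rv by move=> s; apply: val_inj; rewrite /= revK.
rewrite (reindex_inj (inv_inj rvK)) /=.
rewrite (@sum_tuple_cons _ _ _ (fun s => uniq (rev s))
  (fun s => path_wt (rev s) * end_wt l (rev s))).
apply: (@le_trans _ _ (\sum_x (if x == l then theta1 else 1) * walk_sum r [::] x)).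
  apply: ler_sum => x _; rewrite /walk_sum mulr_sumr.
  rewrite big_mkcond [leRHS]big_mkcond; apply: ler_sum => s _.
  rewrite rev_uniq all_predT andbT path_wt_rev end_wt_rev mulrC.
  by case: ifP.
apply: (@le_trans _ _ (\sum_x ((if x == l then theta1 * K else 0) +
    (1 + (x \in p)%:R * (2 * (rho * K)))) * B ^+ r)).
  apply: ler_sum => x _; case: ifP => [/eqP ->|_].
    rewrite mulrDl -[leLHS]addr0; apply: lerD; last first.
      by rewrite mulr_ge0 // addr_ge0 // mulr_ge0 // mulr_ge0.
    rewrite -mulrA ler_wpM2l // (le_trans (walk_sum_le _ _ _)) // ler_wpM2r //.
    apply: le_trans rhoK; rewrite lerD2l ler_piMl //.
    by rewrite lern1 deg_last.
  rewrite mul1r add0r; apply: le_trans (walk_sum_le _ _ _) _; rewrite ler_wpM2r // lerD2l.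
  case: (boolP (x \in p)) => xp; last by rewrite deg_notin // !mul0r.
  by rewrite mul1r ler_wpM2r // ler_nat deg_le2.
rewrite -mulr_suml exprS [leRHS]mulrA ler_wpM2r //.
rewrite !big_split /= -big_mkcond big_pred1_eq sumr_const sum_mem_p.
rewrite [leLHS]addrC [leRHS]mulrDl mul1r.
apply: lerD.
  rewrite /growth lerD2l mulrC ler_wpM2r // ler_wpM2l //.
  by rewrite (le_trans _ rhoK) // lerDr.
rewrite mulrAC ler_wpM2r // (le_trans theta1_le) // ler_wpM2l //.
exact: card_le_growth.
Qed.

Definition suffix_sum (z : V) (p1 p2 : seq V) (l : V) : R :=
  \sum_(s : (size p2).-tuple V | uniq (rcons p1 z ++ s) && (val s != p2))
    walk_wt z s * end_wt l s.

Lemma suffix_sum_le z p1 p2 x0 : rcons p1 z ++ p2 = p ->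
  suffix_sum z p1 p2 (last x0 p) <= K * (1 + mu * K) * growth ^+ (size p2).
Proof.
have C0 : 0 <= 1 + mu * K by rewrite addr_ge0 // mulr_ge0.
elim: p2 z p1 => [|y p2 IHp] z p1 pE.
  rewrite /suffix_sum big1 => [|s /andP[_]]; last by rewrite (tuple0 s) eqxx.
  by rewrite mulr_ge0 ?mulr_ge0 // exprn_ge0 // growth_ge0.
have pE' : rcons (rcons p1 z) y ++ p2 = p by rewrite cat_rcons.
have {}IHp := IHp y _ pE'.
set l := last x0 p in IHp *.
apply: (@le_trans _ _ (theta * suffix_sum y (rcons p1 z) p2 l +
   \sum_(s : (size p2).+1.-tuple V | uniq s) path_wt s * end_wt l s)); last first.
  have := end_sum_le (size p2) x0; rewrite -/l => h.
  apply: le_trans (lerD (ler_wpM2l theta0 IHp) h) _.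
  rewrite /= exprS.
  have Br : 0 <= B ^+ (size p2) by rewrite exprn_ge0 // growth_ge0.
  apply: (@le_trans _ _ ((rho * B) * (K * (1 + mu * K) * B ^+ size p2) +
     (1 + mu * K) * (B * B ^+ (size p2)))).
    rewrite lerD2r ler_wpM2r ?mulr_ge0 // (le_trans theta_le) // ler_wpM2l //.
    exact: card_le_growth.
  rewrite [leLHS](_ : _ = (1 + rho * K) * ((1 + mu * K) * (B * B ^+ size p2))); last by ring.
  by rewrite -(mulrA K) ler_wpM2r // !mulr_ge0 // growth_ge0.
rewrite /suffix_sum /=.
rewrite (@sum_tuple_cons _ _ _ (fun s => uniq (rcons p1 z ++ s) && (s != y :: p2))
  (fun s => walk_wt z s * end_wt l s)).
rewrite (@sum_tuple_cons _ _ _ uniq (fun s => path_wt s * end_wt l s)).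
rewrite (bigD1 y) //=; apply: lerD.
  rewrite /suffix_sum mulr_sumr big_mkcond [leRHS]big_mkcond; apply: ler_sum => s _.
  rewrite eqseq_cons eqxx /= (cat_rcons y (rcons p1 z)).
  case: ifP => // /andP[us sp]; rewrite /step (adj_next pE) -mulrA ler_wpM2l //.
  rewrite ler_wpM2l ?walk_wt_ge0 //.
  by case: (val s) sp (size_tuple s) => [|x s'] //=; case: (p2).
rewrite [leRHS](bigD1 y) //= -[leLHS]add0r; apply: lerD.
  by apply: sumr_ge0 => s _; rewrite mulr_ge0 ?if_wt_ge0 ?walk_wt_ge0.
apply: ler_sum => x xy; rewrite big_mkcond [leRHS]big_mkcond; apply: ler_sum => s _.
case: ifP => [/andP[us _]|_]; last first.
  by case: ifP => // _; rewrite mulr_ge0 ?if_wt_ge0 ?walk_wt_ge0.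
move: us; rewrite cat_uniq => /and3P[_ /hasPn xs /= us]; rewrite us.
by rewrite /step (adj_fresh pE) ?mul1r //; apply: xs; rewrite inE eqxx.
Qed.

(* Other paths are classified by the length of their longest common prefix with
   p; past it they leave p, and what they share with p afterwards is controlled
   by end_sum_le after reversal. *)
Lemma overlap_sum_le z p' : p = z :: p' ->
  \sum_(s : (size p).-tuple V | uniq s && (val s != p))
    (if ohead s == Some z then theta1 else 1) * (path_wt s * end_wt (last z p) s)
  <= (1 + mu * K) ^+ 2 * growth ^+ (size p).
Proof.
move=> pE; have C0 : 0 <= 1 + mu * K by rewrite addr_ge0 // mulr_ge0.
set l := last z p.
have Br : 0 <= B ^+ (size p') by rewrite exprn_ge0 // growth_ge0.
apply: (@le_trans _ _ (theta1 * suffix_sum z [::] p' l +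
   \sum_(s : (size p').+1.-tuple V | uniq s) path_wt s * end_wt l s)); last first.
  have h1 := @suffix_sum_le z [::] p' z (esym pE).
  have h2 := end_sum_le (size p') z; rewrite -/l in h1 h2.
  apply: le_trans (lerD (ler_wpM2l theta1_ge h1) h2) _.
  rewrite pE /= exprS.
  apply: (@le_trans _ _ ((mu * B) * (K * (1 + mu * K) * B ^+ size p') +
     (1 + mu * K) * (B * B ^+ (size p')))).
    rewrite lerD ?exprS // ler_wpM2r ?mulr_ge0 // (le_trans theta1_le) // ler_wpM2l //.
    exact: card_le_growth.
  by rewrite le_eqVlt; apply/orP; left; apply/eqP; ring.
have -> : size p = (size p').+1 by rewrite pE.
rewrite (@sum_tuple_cons _ _ _ (fun s => uniq s && (s != p))
  (fun s => (if ohead s == Some z then theta1 else 1) * (path_wt s * end_wt l s))).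
rewrite (@sum_tuple_cons _ _ _ uniq (fun s => path_wt s * end_wt l s)).
rewrite (bigD1 z) //=; apply: lerD.
  rewrite /suffix_sum mulr_sumr big_mkcond [leRHS]big_mkcond; apply: ler_sum => s _.
  rewrite pE eqseq_cons !eqxx /=.
  case: ifP => // /andP[us sp].
  rewrite ler_wpM2l // ler_wpM2l ?walk_wt_ge0 //.
  case: (val s) sp (size_tuple s) => [|x s'] //=.
  by case: (p').
rewrite [leRHS](bigD1 z) //= -[leLHS]add0r; apply: lerD.
  by apply: sumr_ge0 => s _; rewrite mulr_ge0 ?if_wt_ge0 ?walk_wt_ge0.
apply: ler_sum => x xz; rewrite big_mkcond [leRHS]big_mkcond; apply: ler_sum => s _.
have -> : (Some x == Some z) = false by apply/negbTE.
rewrite mul1r; case: ifP => [/andP[-> _] //|_].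
by case: ifP => // _; rewrite mulr_ge0 ?if_wt_ge0 ?walk_wt_ge0.
Qed.

End Overlap.

(** * Moments of the number of paths *)

Section Edges.
Variable n : nat.
Implicit Types (x y : 'I_n) (s : seq 'I_n).

Definition link x s : seq {set 'I_n} := pairmap (fun u v => [set u; v]) x s.

Definition edge_set (l : seq {set 'I_n}) : {set edge n} := [set e | val e \in l].

Lemma path_edgesE (p : {bseq n of 'I_n}) x s : bseqval p = x :: s ->
  path_edges p = edge_set (link x s).
Proof. by move=> pE; rewrite /path_edges pE. Qed.

Lemma edge_set_cat l1 l2 : edge_set (l1 ++ l2) = edge_set l1 :|: edge_set l2.
Proof. by apply/setP => e; rewrite !inE mem_cat. Qed.

Lemma edge_set_cons e l : edge_set (e :: l) = edge_set [:: e] :|: edge_set l.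
Proof. by rewrite -cat1s edge_set_cat. Qed.

Lemma card_edge_set l : uniq l -> all (fun e : {set 'I_n} => #|e| == 2%N) l ->
  #|edge_set l| = size l.
Proof.
move=> ul /allP l2; rewrite -(card_uniqP ul).
rewrite -(card_imset _ (@val_inj _ _ (edge n))); apply: eq_card => e.
apply/imsetP/idP => [[e' + ->]|el]; first by rewrite inE.
by exists (exist _ e (l2 _ el)) => //; rewrite inE.
Qed.

Lemma mem_link x s e : e \in link x s -> exists p1 a b p2,
  x :: s = rcons p1 a ++ b :: p2 /\ e = [set a; b].
Proof.
elim: s x => // y s IHs x; rewrite /= inE => /orP[/eqP ->|].
  by exists [::], x, y, s.
by move=> /IHs[p1 [a [b [p2 [-> ->]]]]]; exists (x :: p1), a, b, p2.
Qed.

Lemma mem_link_sub x s e a : e \in link x s -> a \in e -> a \in x :: s.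
Proof.
move=> /mem_link[p1 [b [c [p2 [-> ->]]]]]; rewrite !inE mem_cat mem_rcons !inE.
by case/orP => /eqP ->; rewrite eqxx ?orbT.
Qed.

Lemma link_uniq x s : uniq (x :: s) -> uniq (link x s).
Proof.
elim: s x => // y s IHs x /= /andP[xys us]; rewrite IHs // andbT.
by apply: contra xys => /mem_link_sub; apply; rewrite !inE eqxx.
Qed.

Lemma link_card2 x s : uniq (x :: s) -> all (fun e : {set 'I_n} => #|e| == 2%N) (link x s).
Proof.
elim: s x => // y s IHs x /= /andP[xys us]; rewrite IHs // andbT cards2.
by move: xys; rewrite inE negb_or => /andP[->].
Qed.

Lemma card_link x s : uniq (x :: s) -> #|edge_set (link x s)| = size s.
Proof.
by move=> us; rewrite card_edge_set ?link_uniq ?link_card2 // size_pairmap.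
Qed.

Lemma set2_eq (a b x y : 'I_n) : [set a; b] = [set x; y] ->
  (a = x /\ b = y) \/ (a = y /\ b = x).
Proof.
move=> e; have := set21 a b; have := set22 a b; rewrite e !inE.
have := set21 x y; have := set22 x y; rewrite -e !inE.
by do 4![case/orP => /eqP ?]; subst; tauto.
Qed.

Lemma mem_link_adj x s a b : uniq (x :: s) -> [set a; b] \in link x s ->
  adj (x :: s) a b.
Proof.
move=> us /mem_link[p1 [c [d [p2 [sE /set2_eq[[-> ->]|[-> ->]]]]]]].
  by apply: (@adj_next _ _ us p1 _ _ p2).
by rewrite adjC; apply: (@adj_next _ _ us p1 _ _ p2).
Qed.

End Edges.

Section PathCount.
Variables (R : realFieldType) (n : nat).
Hypothesis n2 : (1 < n)%N.

Definition v0 : 'I_n := Ordinal (ltnW n2).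
Definition v1 : 'I_n := Ordinal n2.

Lemma v01 : v0 != v1. Proof. by []. Qed.

Lemma path12P (p : {bseq n of 'I_n}) : path12 p ->
  exists2 s, bseqval p = v0 :: rcons s v1 & uniq (v0 :: rcons s v1).
Proof.
rewrite /path12; case: p => -[|x s] sz /=; first by rewrite ?andbF.
case/lastP: s sz => [|s y] sz /and3P[u /eqP xE /eqP yE].
  by rewrite /= xE in yE.
have x0 : x = v0 by apply: val_inj.
have y1 : y = v1 by apply: val_inj; rewrite /= -yE last_rcons.
by exists s; rewrite -?x0 -?y1.
Qed.

Lemma card_path_edges (p : {bseq n of 'I_n}) : path12 p ->
  #|path_edges p| = (size p).-1 /\ (1 < size p)%N.
Proof.
by case/path12P => s pE us; rewrite (path_edgesE pE) card_link // pE /= !size_rcons.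
Qed.

Lemma card_paths_le k : (0 < k)%N ->
  (#|[set p : {bseq n of 'I_n} | path12 p && (#|path_edges p| == k)]| <= n ^ k.-1)%N.
Proof.
case: k => // k _ /=.
pose g (t : k.-tuple 'I_n) : {bseq n of 'I_n} := insub_bseq n (v0 :: rcons t v1).
have <- : #|[set: k.-tuple 'I_n]| = (n ^ k)%N by rewrite cardsT card_tuple card_ord.
apply: leq_trans (leq_imset_card g _).
apply/subset_leq_card/fintype.subsetP => p; rewrite inE => /andP[pp].
have [-> _] := card_path_edges pp; have [s pE us] := path12P pp.
rewrite pE /= size_rcons eqSS => /eqP sk; apply/imsetP.
have st : size s == k by rewrite sk.
exists (Tuple st); rewrite ?inE //; apply: val_inj => /=.
have szp := size_bseq p; rewrite pE in szp.
by rewrite /g /insub_bseq val_insubd szp.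
Qed.

Lemma sum_paths_le (h : nat -> R) : (forall k, 0 <= h k) ->
  \sum_(p : {bseq n of 'I_n} | path12 p) h #|path_edges p| <=
  \sum_(k < n | (0 < k)%N) n%:R ^+ k.-1 * h k.
Proof.
move=> h0.
have sz (p : {bseq n of 'I_n}) : path12 p -> (0 < #|path_edges p| < n)%N.
  by move=> /card_path_edges[-> s1]; have := size_bseq p; lia.
rewrite (eq_bigr (fun p => \sum_(k < n | (0 < k)%N) (#|path_edges p| == k)%:R * h k)).
  rewrite exchange_big /=; apply: ler_sum => k k0.
  rewrite -mulr_suml ler_wpM2r // -natr_sum -natrX ler_nat.
  apply: leq_trans (card_paths_le k0); rewrite -sum1_card big_mkcond [leqRHS]big_mkcond.
  by apply/eq_leq/eq_bigr => p _; rewrite inE; case: (path12 p) => //=; case: eqP.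
move=> p /sz /andP[c0 cn].
rewrite (bigD1 (Ordinal cn)) //= eqxx mul1r big1 ?addr0 // => k /andP[_ /eqP kc].
by case: eqP => [e|]; rewrite ?mul0r //; case: kc; apply: val_inj.
Qed.

Lemma first_moment (m s t : nat) (Q : pred nat) :
  Ex (fun a : {ffun edge n + edge n -> 'I_m.+1} =>
    [exists p : {bseq n of 'I_n},
       [&& path12 p, Q #|path_edges p| & budget (path_edges p) s t a]]%:R) <=
  \sum_(k < n | (0 < k)%N && Q k)
     n%:R ^+ k.-1 * (simplex_prob R m k s * simplex_prob R m k t).
Proof.
pose h k := (Q k)%:R * (simplex_prob R m k s * simplex_prob R m k t).
have h0 k : 0 <= h k by rewrite !mulr_ge0 // simplex_prob_ge0.
rewrite big_mkcondr /= [leRHS](_ : _ = \sum_(k < n | (0 < k)%N) n%:R ^+ k.-1 * h k); last first.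
  by apply: eq_bigr => k _; rewrite /h; case: ifP => _; rewrite ?mul1r ?mul0r ?mulr0.
apply: le_trans (sum_paths_le h0).
apply: (@le_trans _ _ (\sum_(p : {bseq n of 'I_n} | path12 p)
   Ex (fun a : {ffun edge n + edge n -> 'I_m.+1} =>
     (Q #|path_edges p|)%:R * (budget (path_edges p) s t a)%:R))).
  rewrite -Ex_sum; apply: le_Ex => a.
  case: existsP => [[p /and3P[pp Qp bp]]|_].
    by rewrite (bigD1 p) //= Qp bp mulr1 lerDl sumr_ge0 // => *; rewrite mulr_ge0.
  by apply: sumr_ge0 => p _; rewrite mulr_ge0.
apply: ler_sum => p _; rewrite ExZ /h ler_wpM2l //.
exact: Ex_budget_le.
Qed.

End PathCount.

Section SimplexProbRatio.
Variables (R : realFieldType) (m : nat).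
Local Notation sp := (simplex_prob R m).
Local Notation M := (m.+1%:R : R).

Lemma simplex_prob0 s : sp 0 s = 1.
Proof. by rewrite /simplex_prob bin0 expr0 divr1. Qed.

Lemma simplex_prob1 s : sp 1 s = s.+1%:R / M.
Proof. by rewrite /simplex_prob bin1 expr1 addn1. Qed.

Lemma simplex_prob_pred k s : (0 < s)%N ->
  sp k s <= sp k.+1 s * (k.+1%:R * M / s%:R).
Proof.
move=> s0; have M0 : 0 < M by rewrite ltr0n.
have s0' : 0 < s%:R :> R by rewrite ltr0n.
rewrite /simplex_prob exprS invfM.
rewrite [leRHS](_ : _ = (k.+1%:R * 'C(s + k.+1, k.+1)%:R / s%:R) * (M ^+ k)^-1); last first.
  by field; rewrite ?expf_neq0 ?gt_eqF.
rewrite ler_pM2r ?invr_gt0 ?exprn_gt0 // ler_pdivlMr //.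
by rewrite -!natrM ler_nat addnS -mul_bin_diag mulnC leq_mul2r leqW ?leq_addr ?orbT.
Qed.

Lemma simplex_prob_sub k i s : (0 < s)%N -> (i <= k)%N ->
  sp (k - i) s <= sp k s * (k%:R * M / s%:R) ^+ i.
Proof.
move=> s0; have M0 : 0 < M by rewrite ltr0n.
elim: i => [|i IHi] ik; first by rewrite subn0 mulr1.
apply: le_trans (@simplex_prob_pred _ _ s0) _.
have <- : (k - i = (k - i.+1).+1)%N by lia.
rewrite exprSr [leRHS]mulrA; apply: ler_pM.
- exact: simplex_prob_ge0.
- by rewrite !mulr_ge0.
- exact: IHi (ltnW ik).
- by rewrite -!mulrA ler_wpM2r ?divr_ge0 // ler_nat leq_subr.
Qed.

End SimplexProbRatio.

Section SecondMoment.
Variables (R : realFieldType) (n : nat).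
Hypothesis n2 : (1 < n)%N.
Variables (m s t s1 t1 k : nat).
Hypotheses (sm : (s <= m)%N) (tm : (t <= m)%N) (s1m : (s1 <= m)%N) (t1m : (t1 <= m)%N).
Hypotheses (k0 : (0 < k)%N) (s0 : (0 < s)%N) (t0 : (0 < t)%N).
Local Notation sp := (simplex_prob R m).
Local Notation M := (m.+1%:R : R).
Local Notation Omega := {ffun edge n + edge n -> 'I_m.+1}.
Local Notation v0 := (v0 n2).
Local Notation v1 := (v1 n2).
Implicit Types (v u : seq 'I_n) (S : {set edge n}).

Definition triple S1 S2 S3 (a : Omega) : bool :=
  [&& budget S1 s1 t1 a, budget S2 s t a & budget S3 s1 t1 a].

Let q j : R := sp j s1 * sp j t1.
Let p j : R := sp j s * sp j t.

Lemma tripleE S1 S2 S3 a : (triple S1 S2 S3 a)%:R =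
  (budget S1 s1 t1 a)%:R * ((budget S2 s t a)%:R * (budget S3 s1 t1 a)%:R) :> R.
Proof. by rewrite /triple; do 3! case: budget; rewrite ?(mul0r, mulr0, mulr1). Qed.

Lemma coords_sub S S' : S \subset S' -> coords S \subset coords S'.
Proof. by move=> /fintype.subsetP sS; apply/fintype.subsetP => -[e|e]; rewrite !inE; apply: sS. Qed.

Lemma triple_depends S1 S2 S3 :
  depends_on (coords (S1 :|: S2 :|: S3)) (fun a => (triple S1 S2 S3 a)%:R : R).
Proof.
move=> a b ab; rewrite !tripleE; congr (_ * (_ * _)); apply: budget_natr_depends => i iS;
  apply: ab; apply: fintype.subsetP iS; apply: coords_sub; rewrite -finset.setUA.
- exact: finset.subsetUl.
- by rewrite finset.setUCA finset.subsetUl.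
- by rewrite finset.setUA finset.subsetUr.
Qed.

Lemma budget_depends_disjoint S S' i j : [disjoint S & S'] ->
  depends_on (~: coords S') (fun a : Omega => (budget S i j a)%:R : R).
Proof.
move=> d; apply: (@depends_onS _ _ (coords S)); first exact: coordsC.
exact: budget_natr_depends.
Qed.

Lemma Ex_triple_mul S1 S2 S3 (g : Omega -> R) :
  [disjoint S1 & S2] -> [disjoint S1 & S3] -> [disjoint S2 & S3] ->
  depends_on (~: coords (S1 :|: S2 :|: S3)) g ->
  Ex (fun a => (triple S1 S2 S3 a)%:R * g a) = q #|S1| * p #|S2| * q #|S3| * Ex g.
Proof.
move=> d12 d13 d23 gS.
have gi S : S \subset S1 :|: S2 :|: S3 -> depends_on (~: coords S) g.
  by move=> sS; apply: depends_onS gS; rewrite finset.setCS coords_sub.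
under eq_Ex => a do rewrite tripleE -!mulrA.
rewrite Ex_budget_mul //; last first.
  apply: depends_on_mul; last apply: depends_on_mul.
  - by apply: budget_depends_disjoint; rewrite disjoint_sym.
  - by apply: budget_depends_disjoint; rewrite disjoint_sym.
  - by apply: gi; rewrite -finset.setUA finset.subsetUl.
rewrite Ex_budget_mul //; last first.
  apply: depends_on_mul.
  - by apply: budget_depends_disjoint; rewrite disjoint_sym.
  - by apply: gi; rewrite finset.setUAC finset.subsetUr.
rewrite Ex_budget_mul //; last by apply: gi; rewrite finset.subsetUr.
by rewrite /q /p !mulrA.
Qed.

Definition first_edge v : {set edge n} := edge_set [:: [set v0; head v0 v]].
Definition middle_edges v : {set edge n} := edge_set (behead (link v0 v)).
Definition last_edge v : {set edge n} := edge_set [:: [set last v0 v; v1]].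
Definition all_edges v : {set edge n} := first_edge v :|: middle_edges v :|: last_edge v.

Definition interior v : bool := uniq (v0 :: rcons v v1).

Lemma interiorE v : interior v = [&& uniq v, v0 \notin v & v1 \notin v].
Proof.
rewrite /interior /= rcons_uniq mem_rcons inE negb_or /=.
by case: uniq; case: (v0 \in v); case: (v1 \in v).
Qed.

Lemma interior_head v : (0 < size v)%N -> interior v ->
  head v0 v != v0 /\ head v0 v != v1.
Proof.
case: v => // x v _; rewrite interiorE => /and3P[_].
by rewrite !inE !negb_or /= !(eq_sym x) => /andP[-> _] /andP[-> _].
Qed.

Lemma interior_last v : (0 < size v)%N -> interior v ->
  last v0 v != v0 /\ last v0 v != v1.
Proof.
case/lastP: v => // v x _; rewrite interiorE last_rcons => /and3P[_].
by rewrite !mem_rcons !inE !negb_or !(eq_sym x) => /andP[-> _] /andP[-> _].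
Qed.

Lemma link_rcons (x : 'I_n) v (y : 'I_n) : link x (rcons v y) = rcons (link x v) [set last x v; y].
Proof. by elim: v x => //= z v IHv x; rewrite IHv. Qed.

Lemma link_split v : (0 < size v)%N ->
  link v0 (rcons v v1) =
  [:: [set v0; head v0 v]] ++ behead (link v0 v) ++ [:: [set last v0 v; v1]].
Proof. by case: v => // x v _; rewrite link_rcons -cats1. Qed.

Lemma all_edgesE v : (0 < size v)%N -> all_edges v = edge_set (link v0 (rcons v v1)).
Proof. by move=> v_0; rewrite link_split // !edge_set_cat finset.setUA. Qed.

Lemma edge_set_disjoint (l1 l2 : seq {set 'I_n}) : uniq (l1 ++ l2) ->
  [disjoint edge_set l1 & edge_set l2].
Proof.
rewrite cat_uniq => /and3P[_ /hasPn h _]; apply/pred0P => e /=; rewrite !inE.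
by apply/negP => /andP[el1 /h]; rewrite el1.
Qed.

Lemma interior_edges v : size v = k.+1 -> interior v ->
  [/\ [disjoint first_edge v & middle_edges v],
      [disjoint first_edge v & last_edge v],
      [disjoint middle_edges v & last_edge v] &
      [/\ #|first_edge v| = 1%N, #|middle_edges v| = k & #|last_edge v| = 1%N]].
Proof.
move=> sv iv; have v_0 : (0 < size v)%N by rewrite sv.
have u := link_uniq iv; have c2 := link_card2 iv.
rewrite link_split // in u c2.
move: c2; rewrite !all_cat => /and3P[c1 c2 c3].
have szb : size (behead (link v0 v)) = k by rewrite size_behead size_pairmap sv.
move: (u); rewrite catA cat_uniq => /and3P[u12 _ u3].
move: (u); rewrite cat_uniq => /and3P[u1 _ u23].
split.
- exact: edge_set_disjoint.
- apply: edge_set_disjoint; apply: subseq_uniq u; apply: cat_subseq => //.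
  exact: suffix_subseq.
- exact: edge_set_disjoint.
- split; rewrite card_edge_set //.
  by move: u12; rewrite cat_uniq => /and3P[].
Qed.

Lemma Ex_path v : size v = k.+1 -> interior v ->
  Ex (fun a => (triple (first_edge v) (middle_edges v) (last_edge v) a)%:R) =
  q 1 * p k * q 1.
Proof.
move=> sv iv; have [d12 d13 d23 [c1 c2 c3]] := interior_edges sv iv.
under eq_Ex => a do rewrite -[_%:R]mulr1.
by rewrite Ex_triple_mul // c1 c2 c3 Ex_cst mulr1.
Qed.

Definition theta : R := (k%:R * M / s%:R) * (k%:R * M / t%:R).

Lemma theta_ge1 : 1 <= theta.
Proof.
have aux j : (0 < j)%N -> (j <= m)%N -> 1 <= k%:R * M / j%:R.
  move=> j0 jm; rewrite ler_pdivlMr ?ltr0n // mul1r -natrM ler_nat.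
  by apply: (@leq_trans m.+1); [exact: leqW|rewrite leq_pmull].
by rewrite -[leLHS]mulr1 ler_pM // aux.
Qed.

Lemma p_sub i : (i <= k)%N -> p (k - i) <= p k * theta ^+ i.
Proof.
move=> ik; rewrite /p /theta exprMn [leRHS]mulrACA.
by apply: ler_pM; rewrite ?simplex_prob_ge0 ?simplex_prob_sub.
Qed.

Lemma shared_middle v u : size v = k.+1 -> interior v -> interior u ->
  theta ^+ #|middle_edges u :&: all_edges v| <= path_wt v theta u.
Proof.
move=> sv iv iu.
have v_0 : (0 < size v)%N by rewrite sv.
case: u iu => [|x u] iu.
  by rewrite /middle_edges /= /path_wt (_ : edge_set [::] = finset.set0) ?finset.set0I ?cards0 //;
     apply/setP => e; rewrite !inE.
rewrite /middle_edges /=.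
have {iu} : all (fun y => (y != v0) && (y != v1)) (x :: u).
  move: iu; rewrite interiorE => /and3P[_ h0 h1]; apply/allP => y yu.
  by apply/andP; split; [apply: contraNneq h0 => <-|apply: contraNneq h1 => <-].
elim: u x => [|y u IHu] x /=.
  by rewrite (_ : edge_set [::] = finset.set0) ?finset.set0I ?cards0 //;
     apply/setP => e; rewrite !inE.
move=> /andP[x01 yu01]; have := IHu y yu01; move: yu01 => /= /andP[y01 _] {}IHu.
rewrite edge_set_cons finset.setIUl.
apply: (@le_trans _ _ (theta ^+ (#|edge_set [:: [set x; y]] :&: all_edges v| +
    #|edge_set (link y u) :&: all_edges v|))).
  by apply: ler_weXn2l; [exact: theta_ge1|exact: leq_card_setU].
rewrite exprD; apply: ler_pM => //; try by rewrite exprn_ge0 // (le_trans ler01) // theta_ge1.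
rewrite /step; case: ifP => [_|nadj].
  rewrite -[leRHS]expr1; apply: ler_weXn2l; first exact: theta_ge1.
  apply: (@leq_trans #|edge_set [:: [set x; y]]|); first exact/subset_leq_card/finset.subsetIl.
  rewrite -[leqRHS](cards1 [set x; y]) -(card_imset _ (@val_inj _ _ (edge n))).
  by apply/subset_leq_card/fintype.subsetP => _ /imsetP[e + ->]; rewrite !inE.
rewrite (_ : _ :&: _ = finset.set0) ?cards0 ?expr0 //; apply/setP => e; rewrite !inE.
apply/negP => /andP[/eqP ->] /orP[/orP[/eqP /set2_eq|]|/eqP /set2_eq].
- move: x01 y01 => /andP[/eqP x0 _] /andP[/eqP y0 _]; tauto.
- case: v v_0 {sv IHu} iv nadj => // z v _; rewrite interiorE => /and3P[uv _ _] nadj /=.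
  by move=> /(mem_link_adj uv); rewrite nadj.
- move: x01 y01 => /andP[_ /eqP x1] /andP[_ /eqP y1]; tauto.
Qed.

Variables (rho K mu : R).
Hypotheses (rho0 : 0 <= rho) (K0 : 0 <= K) (rhoK : 1 + rho * K <= K).
Hypotheses (theta_le : theta <= rho * n%:R).
Hypotheses (mu0 : 0 <= mu) (q_ge : (q 1)^-1 <= mu * n%:R).

Lemma sp_gt0 j i : 0 < sp j i.
Proof. by rewrite divr_gt0 ?exprn_gt0 ?ltr0n // bin_gt0 leq_addl. Qed.

Lemma q_gt0 j : 0 < q j. Proof. by rewrite mulr_gt0 ?sp_gt0. Qed.
Lemma p_gt0 j : 0 < p j. Proof. by rewrite mulr_gt0 ?sp_gt0. Qed.
Lemma q0 : q 0 = 1. Proof. by rewrite /q !simplex_prob0 mulr1. Qed.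

Lemma shared_first v u : size v = k.+1 -> interior v -> size u = k.+1 -> interior u ->
  q #|first_edge u :\: all_edges v| <= q 1 * (if head v0 u == head v0 v then (q 1)^-1 else 1).
Proof.
move=> sv iv su iu; case: eqP => uv.
  rewrite divff ?gt_eqF ?q_gt0 // (_ : _ :\: _ = finset.set0) ?cards0 ?q0 //.
  apply/eqP; rewrite finset.setD_eq0 /first_edge uv /all_edges -finset.setUA.
  exact: finset.subsetUl.
rewrite mulr1 (_ : _ :\: _ = first_edge u).
  by have [_ _ _ [-> _ _]] := interior_edges su iu.
apply/eqP; rewrite finset.eqEsubset finset.subsetDl /=; apply/fintype.subsetP => e.
rewrite !inE => /eqP ->; rewrite eqxx andbT.
have [u_0 v_0] : (0 < size u)%N /\ (0 < size v)%N by rewrite su sv.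
have [hu0 hu1] := interior_head u_0 iu; have [hv0 hv1] := interior_head v_0 iv.
have [lv0 lv1] := interior_last v_0 iv.
apply/negP => /orP[/orP[/eqP /set2_eq|]|/eqP /set2_eq].
- by move: hv0 => /eqP; intuition congruence.
- case: v v_0 {sv uv hv0 hv1 lv0 lv1} iv => // z v _; rewrite interiorE => /and3P[_ + _] /=.
  by move=> /negP zv /mem_link_sub h; apply: zv; apply: h; rewrite !inE eqxx.
- by move: lv0 (v01 n2) => /eqP ? /eqP ?; intuition congruence.
Qed.

Lemma shared_last v u : size v = k.+1 -> interior v -> size u = k.+1 -> interior u ->
  q #|last_edge u :\: all_edges v| <= q 1 * (if last v0 u == last v0 v then (q 1)^-1 else 1).
Proof.
move=> sv iv su iu; case: eqP => uv.
  rewrite divff ?gt_eqF ?q_gt0 // (_ : _ :\: _ = finset.set0) ?cards0 ?q0 //.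
  apply/eqP; rewrite finset.setD_eq0 /last_edge uv /all_edges.
  exact: finset.subsetUr.
rewrite mulr1 (_ : _ :\: _ = last_edge u).
  by have [_ _ _ [_ _ ->]] := interior_edges su iu.
apply/eqP; rewrite finset.eqEsubset finset.subsetDl /=; apply/fintype.subsetP => e.
rewrite !inE => /eqP ->; rewrite eqxx andbT.
have [u_0 v_0] : (0 < size u)%N /\ (0 < size v)%N by rewrite su sv.
have [lu0 lu1] := interior_last u_0 iu; have [lv0 lv1] := interior_last v_0 iv.
have [hv0 hv1] := interior_head v_0 iv.
apply/negP => /orP[/orP[/eqP /set2_eq|]|/eqP /set2_eq].
- by move: lu0 (v01 n2) => /eqP ? /eqP ?; intuition congruence.
- case: v v_0 {sv uv hv0 hv1 lv0 lv1} iv => // z v _; rewrite interiorE => /and3P[_ _ +] /=.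
  by move=> /negP zv /mem_link_sub h; apply: zv; apply: h; rewrite !inE eqxx orbT.
- by move: lu1 => /eqP ?; intuition congruence.
Qed.

Definition path_prob : R := q 1 * p k * q 1.

Definition good v (a : Omega) : bool :=
  triple (first_edge v) (middle_edges v) (last_edge v) a.

(* The part of u outside v is independent of v, which bounds the conditional
   probability of u by path_prob up to a factor for each shared edge. *)
Lemma Ex_pair v u : size v = k.+1 -> interior v -> size u = k.+1 -> interior u ->
  Ex (fun a => (good v a)%:R * (good u a)%:R) <= path_prob ^+ 2 *
  ((if head v0 u == head v0 v then (q 1)^-1 else 1) *
   (path_wt v theta u * (if last v0 u == last v0 v then (q 1)^-1 else 1))).
Proof.
move=> sv iv su iu; pose D := all_edges v.
have [d12 d13 d23 [_ ck _]] := interior_edges su iu.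
apply: (@le_trans _ _ (Ex (fun a : Omega => (good v a)%:R *
   (triple (first_edge u :\: D) (middle_edges u :\: D) (last_edge u :\: D) a)%:R))).
  apply: le_Ex => a; rewrite ler_wpM2l // ler_nat.
  case: (boolP (good u a)) => // /and3P[h1 h2 h3]; rewrite lt0b /triple.
  by rewrite !(budgetS (finset.subsetDl _ _)).
have sD S : S :\: D \subset S by exact: finset.subsetDl.
have dD S : [disjoint S :\: D & D].
  by rewrite -finset.setI_eq0 finset.setIDAC finset.setDIl finset.setDv finset.setI0.
have [e12 e13 e23 [c1 c2 c3]] := interior_edges sv iv.
rewrite Ex_triple_mul //; last first.
  apply: (@depends_onS _ _ (coords ((first_edge u :|: middle_edges u :|: last_edge u) :\: D))).
    exact: (coordsC (dD _)).
  by rewrite !finset.setDUl; exact: triple_depends.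
rewrite c1 c2 c3 -/path_prob expr2 -mulrA ler_wpM2l //; first by rewrite !mulr_ge0 // ltW ?q_gt0 ?p_gt0.
under eq_Ex => a do rewrite -[_%:R]mulr1.
have dsub S S' : [disjoint S & S'] -> [disjoint S :\: D & S' :\: D].
  by move=> d; apply: disjointWl (sD S) _; apply: disjointWr (sD S') d.
rewrite Ex_triple_mul ?dsub // Ex_cst mulr1.
have h1 := shared_first sv iv su iu; have h3 := shared_last sv iv su iu.
have ik : (#|middle_edges u :&: D| <= k)%N.
  by rewrite -ck; apply/subset_leq_card/finset.subsetIl.
have h2 : p #|middle_edges u :\: D| <= p k * path_wt v theta u.
  rewrite finset.cardsD ck; apply: le_trans (p_sub ik) _.
  by rewrite ler_pM2l ?p_gt0 // shared_middle.
apply: le_trans (ler_pM _ _ (ler_pM _ _ h1 h2) h3) _; rewrite ?mulr_ge0 ?(ltW (q_gt0 _)) ?(ltW (p_gt0 _)) //.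
by rewrite le_eqVlt /path_prob; apply/orP; left; apply/eqP; ring.
Qed.

Local Notation paths := [set v : k.+1.-tuple 'I_n | interior v].

Definition path_count (a : Omega) : R := \sum_(v in paths) (good v a)%:R.

Lemma Ex_path_count : Ex path_count = #|paths|%:R * path_prob.
Proof.
rewrite /path_count Ex_sum (eq_bigr (fun=> path_prob)).
  by rewrite sumr_const mulr_natl.
by move=> v; rewrite inE => iv; rewrite Ex_path // size_tuple.
Qed.

Lemma path_prob_gt0 : 0 < path_prob.
Proof. exact: mulr_gt0 (mulr_gt0 (q_gt0 1) (p_gt0 k)) (q_gt0 1). Qed.

Definition overlap_bound : R := (1 + mu * K) ^+ 2 * (n%:R + 2 * K * k.+1%:R) ^+ k.+1.

Lemma overlap_le v : size v = k.+1 -> uniq v ->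
  \sum_(u : (size v).-tuple 'I_n | uniq u && (val u != v))
    (if ohead u == ohead v then (q 1)^-1 else 1) *
    (path_wt v theta u * end_wt (q 1)^-1 (last v0 v) u) <= overlap_bound.
Proof.
case: v => [//|z v] sv uv.
have q1 : 0 <= (q 1)^-1 by rewrite invr_ge0 ltW // q_gt0.
have th0 : 0 <= theta by apply: le_trans theta_ge1.
have := @overlap_sum_le R _ (z :: v) theta uv rho K mu (q 1)^-1 rho0 K0 rhoK th0.
rewrite card_ord => /(_ theta_le mu0 q1 q_ge z v erefl).
by rewrite /growth card_ord sv.
Qed.

Lemma Ex_path_count_sqr : Ex (fun a => path_count a ^+ 2) <=
  #|paths|%:R * path_prob + #|paths|%:R * path_prob ^+ 2 * overlap_bound.
Proof.
under eq_Ex => a do rewrite expr2 {1}/path_count mulr_suml.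
have -> : #|paths|%:R * path_prob + #|paths|%:R * path_prob ^+ 2 * overlap_bound =
    (path_prob + path_prob ^+ 2 * overlap_bound) *+ #|paths|.
  by rewrite -[RHS]mulr_natl; ring.
rewrite Ex_sum -sumr_const.
apply: ler_sum => v; rewrite inE => iv.
have sv := size_tuple v.
under eq_Ex => a do rewrite /path_count mulr_sumr.
rewrite Ex_sum (bigD1 v) ?inE //=; apply: lerD.
  rewrite /path_prob -(Ex_path sv iv); apply: le_Ex => a.
  by rewrite -/(good v a); case: (good v a); rewrite ?mulr1 ?mul0r.
apply: (@le_trans _ _ (\sum_(u : (size v).-tuple 'I_n | uniq u && (val u != val v))
   path_prob ^+ 2 * ((if ohead u == ohead v then (q 1)^-1 else 1) *
   (path_wt v theta u * end_wt (q 1)^-1 (last v0 v) u)))); last first.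
  rewrite -mulr_sumr ler_wpM2l ?exprn_ge0 ?(ltW path_prob_gt0) //.
  by apply: overlap_le => //; move: iv; rewrite interiorE => /and3P[].
rewrite sv [leLHS]big_mkcond [leRHS]big_mkcond /=; apply: ler_sum => u _.
have su := size_tuple u.
case: ifP => [|_]; last first.
  have q1 : 0 <= (q 1)^-1 by rewrite invr_ge0 ltW // q_gt0.
  have th0 : 0 <= theta by apply: le_trans theta_ge1.
  by case: ifP => // _; rewrite !mulr_ge0 ?exprn_ge0 ?(ltW path_prob_gt0) ?if_wt_ge0 ?path_wt_ge0 ?end_wt_ge0.
rewrite inE => /andP[iu uv]; have := iu; rewrite interiorE => /and3P[-> _ _].
rewrite uv /=; apply: le_trans (Ex_pair sv iv su iu) _.
by case: (val u) su => [//|x u'] su; case: (val v) sv.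
Qed.

Lemma second_moment : (0 < #|paths|)%N ->
  Ex (fun a : Omega => (~~ [exists v in paths, good v a])%:R) <=
  (#|paths|%:R * path_prob)^-1 + overlap_bound / #|paths|%:R - 1.
Proof.
move=> N0; have N0' : 0 < #|paths|%:R :> R by rewrite ltr0n.
have P0 := path_prob_gt0.
set E1 := #|paths|%:R * path_prob.
have E0 : 0 < E1 by rewrite mulr_gt0.
have -> : E1^-1 + overlap_bound / #|paths|%:R - 1 =
   (E1 + #|paths|%:R * path_prob ^+ 2 * overlap_bound - E1 ^+ 2) / E1 ^+ 2.
  by rewrite /E1; field; rewrite !gt_eqF.
rewrite ler_pdivlMr ?exprn_gt0 // mulrC -ExZ.
apply: (@le_trans _ _ (Ex (fun a => path_count a ^+ 2 + - (2 * E1) * path_count a + E1 ^+ 2))).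
  apply: le_Ex => a; case: (boolP [exists v in paths, good v a]) => /= h.
    rewrite mulr0 (_ : _ + _ = (path_count a - E1) ^+ 2); last by ring.
    exact: sqr_ge0.
  rewrite (_ : path_count a = 0) ?mulr1 ?mulr0 ?expr0n ?add0r //.
  rewrite /path_count big1 // => v vp; case: (boolP (good v a)) => // gv.
  by case/negP: h; apply/existsP; exists v; rewrite vp.
rewrite !ExD ExZ Ex_path_count Ex_cst -/E1.
have := Ex_path_count_sqr; rewrite -/E1 => h.
have -> : Ex (fun a => path_count a ^+ 2) + - (2 * E1) * E1 + E1 ^+ 2 =
  Ex (fun a => path_count a ^+ 2) - E1 ^+ 2 by ring.
by rewrite lerD2r.
Qed.

Lemma card_paths : #|paths| = (n - 2) ^_ k.+1.
Proof.
pose A : {set 'I_n} := ~: [set v0; v1].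
have cA : #|A| = (n - 2)%N.
  by rewrite /A finset.cardsCs finset.setCK card_ord cards2 (v01 n2).
rewrite -cA -card_uniq_tuples; apply: eq_card => v; rewrite !inE interiorE andbC.
congr (_ && _); apply/andP/allP => [[h0 h1] y yv|h].
  change (is_true (y \in A)); rewrite !inE negb_or; apply/andP; split;
    [apply: contraNneq h0 => <-|apply: contraNneq h1 => <-]; exact: yv.
have {}h y : y \in val v -> y \in A := h y.
by split; apply/negP => /h; rewrite !inE eqxx ?orbT.
Qed.

End SecondMoment.

(** * From cells of the cube to the original random variables *)

Section UniformCell.
Local Open Scope classical_set_scope.

Lemma uniform_prob_cell (R : realType) (m j : nat) : (j <= m)%N ->
  uniform_prob (@ltr01 R) `[j%:R / m.+1%:R, j.+1%:R / m.+1%:R[ = (m.+1%:R^-1)%:E.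
Proof.
move=> jm; have M0 : 0 < m.+1%:R :> R by rewrite ltr0n.
have sub : `[j%:R / m.+1%:R, j.+1%:R / m.+1%:R[ `<=` (`[0, 1] : set R).
  move=> x; rewrite /= !in_itv /= => /andP[h1 h2]; apply/andP; split.
    by apply: le_trans h1; rewrite divr_ge0.
  by apply: le_trans (ltW h2) _; rewrite ler_pdivrMr // mul1r ler_nat.
rewrite /uniform_prob integral_uniform_pdf setIidl //.
rewrite (eq_integral (fun=> 1%:E)); last first.
  by move=> x; rewrite inE => /sub; rewrite /= in_itv /= /uniform_pdf subr0 invr1 => ->.
rewrite integral_cst //= lebesgue_measure_itv /= lte_fin.
rewrite ltr_pM2r ?invr_gt0 // ltr_nat ltnSn mul1e -EFinB -mulrBl.
by rewrite -addn1 natrD addrAC subrr add0r mul1r.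
Qed.

End UniformCell.

Section Cells.
Local Open Scope classical_set_scope.
Context d (T : measurableType d) (R : realType) (P : probability T R).
Variables (I : finType) (X : I -> {RV P >-> R}) (m : nat).
Hypothesis X_unif : forall i, uniform01 (X i).
Hypothesis X_indep : mutually_independent X.
Local Notation Omega := {ffun I -> 'I_m.+1}.

Definition cell (a : Omega) : set T :=
  \bigcap_(i in [set: I]) X i @^-1` `[(a i)%:R / m.+1%:R, (a i).+1%:R / m.+1%:R[.

Lemma measurable_cell a : measurable (cell a).
Proof.
apply: fin_bigcap_measurable => // i _.
by rewrite -[X in measurable X]setTI; apply: measurable_funP.
Qed.

Lemma prob_cell a : P (cell a) = ((m.+1%:R ^+ #|I|)^-1)%:E.
Proof.
pose B i : set R := `[(a i)%:R / m.+1%:R, (a i).+1%:R / m.+1%:R[.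
have := @X_indep (finset.setTfor I) B (fun i _ => measurable_itv _).
rewrite (_ : [set` (finset.setTfor I)] = [set: I]); last first.
  by apply/seteqP; split => // i _ /=; rewrite inE.
rewrite -/(cell a) => ->.
rewrite (eq_bigr (fun=> (m.+1%:R^-1)%:E)) => [|i _]; last first.
  have <- := @uniform_prob_cell R m (a i) (ltn_ord (a i)).
  by rewrite -(X_unif i (measurable_itv _)).
by rewrite -(big_morph EFin (@EFinM R) erefl) prodr_const cardsT exprVn.
Qed.

Lemma cell_disjoint : trivIset [set: Omega] cell.
Proof.
apply/trivIsetP => a b _ _; apply: contra_neq_eq => /set0P[w [aw bw]].
apply/ffunP => i; apply: val_inj => /=.
have M0 : 0 < m.+1%:R^-1 :> R by rewrite invr_gt0 ltr0n.
have := aw i Logic.I; have := bw i Logic.I; rewrite /= !in_itv /=.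
move=> /andP[b1 b2] /andP[a1 a2].
have := le_lt_trans a1 b2; have := le_lt_trans b1 a2.
rewrite !ltr_pM2r // !ltr_nat; lia.
Qed.

Lemma prob_ge_cells (bad : pred Omega) (A : set T) (eta : R) :
  measurable A -> (forall a, ~~ bad a -> cell a `<=` A) ->
  Ex (fun a => (bad a)%:R) <= eta -> ((1 - eta)%:E <= P A)%E.
Proof.
move=> mA subA badE.
pose r := enum [pred a | ~~ bad a].
have mU : measurable (\bigcup_(a in [set` r]) cell a).
  by apply: fin_bigcup_measurable => [|a _]; [exact: finite_finset|exact: measurable_cell].
apply: (@le_trans _ _ (P (\bigcup_(a in [set` r]) cell a))); last first.
  apply: le_measure; rewrite ?inE //.
  by apply: bigcup_sub => a /=; rewrite mem_enum; exact: subA.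
rewrite measure_fin_bigcup; last by move=> a _; exact: measurable_cell.
- rewrite -fsbig_seq ?enum_uniq // (eq_bigr (fun=> ((m.+1%:R ^+ #|I|)^-1)%:E)) => [|a _]; last first.
    exact: prob_cell.
  rewrite sumEFin lee_fin big_enum /=.
  rewrite lerBlDr -lerBlDl; apply: le_trans badE.
  have -> : \sum_(a in [pred a | ~~ bad a]) m.+1%:R ^- #|I| =
      (\sum_(a : Omega | ~~ bad a) 1) / m.+1%:R ^+ #|I| :> R.
    by rewrite mulr_suml; apply: eq_bigr => a _; rewrite mul1r.
  rewrite -[X in X - _](@Ex_cst R I m) /Ex -mulrBl ler_wpM2r ?invr_ge0 ?exprn_ge0 //.
  rewrite [X in _ - X]big_mkcond -sumrB; apply: ler_sum => a _ /=.
  by case: (bad a); rewrite /= ?subr0 ?subrr.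
- exact: finite_finset.
- exact: sub_trivIset (@subsetT _ _) cell_disjoint.
Qed.

End Cells.
Section MeasurableEvent.
Local Open Scope classical_set_scope.
Context d (T : measurableType d) (R : realType) (P : probability T R).
Variables (n : nat) (w c : edge n -> {RV P >-> R}) (c0 : R).

Lemma measurable_weight (x : edge n -> {RV P >-> R}) (p : {bseq n of 'I_n}) :
  measurable_fun setT (fun omega => weight (fun e => x e omega) p).
Proof.
rewrite /weight; under eq_fun => omega do rewrite big_mkcond /=.
apply: (@measurable_sum _ _ _ _ _ _
  (fun e omega => if e \in path_edges p then x e omega else 0)) => e.
by case: (e \in path_edges p); [exact: measurable_funP|exact: measurable_cst].
Qed.

Lemma measurable_feasible (p : {bseq n of 'I_n}) :
  measurable_fun setT (fun omega => feasible (fun e => c e omega) c0 p).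
Proof.
rewrite /feasible; case: (path12 p) => /=; last exact: measurable_cst.
by apply: measurable_fun_ler; [exact: measurable_weight|exact: measurable_cst].
Qed.

Lemma measurable_min_length :
  measurable_fun setT
    (fun omega => min_length (fun e => w e omega) (fun e => c e omega) c0).
Proof.
rewrite /min_length; under eq_fun => omega do rewrite big_mkcond /=.
elim: (index_enum _) => [|p s IHs].
  by under eq_fun => omega do rewrite big_nil; exact: measurable_cst.
under eq_fun => omega do rewrite big_cons; apply: measurable_mine => //.
apply: measurable_fun_ifT; [exact: measurable_feasible| |exact: measurable_cst].
by apply/measurable_EFinP; exact: measurable_weight.
Qed.

Lemma measurable_rel_close (f : T -> \bar R) (eps b : R) :
  measurable_fun setT f -> measurable [set omega | rel_close eps (f omega) b].
Proof.
move=> mf; rewrite /rel_close -[X in measurable X]setTI.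
apply: emeasurable_fun_infty_c => //.
apply: measurableT_comp => //; apply: emeasurable_funB => //.
by apply: emeasurable_funM => //; exact: measurable_cst.
Qed.

Lemma measurable_close_event (eps b1 b2 : R) : measurable [set omega : T |
  rel_close eps (min_length (fun e => w e omega) (fun e => c e omega) c0) b1
  /\ forall p : {bseq n of 'I_n},
    optimal (fun e => w e omega) (fun e => c e omega) c0 p ->
    rel_close eps (#|path_edges p|%:R%:E) b2].
Proof.
apply: measurableI; first exact/measurable_rel_close/measurable_min_length.
rewrite [X in measurable X](_ : _ = \bigcap_(p in [set: {bseq n of 'I_n}])
  ([set omega | optimal (fun e => w e omega) (fun e => c e omega) c0 p = false] `|`
   [set _ | rel_close eps (#|path_edges p|%:R%:E) b2])).
  apply: fin_bigcap_measurable => // p _; apply: measurableU; last first.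
    by apply: measurable_rel_close; exact: measurable_cst.
  rewrite -[X in measurable X]setTI.
  have mo : measurable_fun setT
      (fun omega => optimal (fun e => w e omega) (fun e => c e omega) c0 p).
    apply: measurable_and; first exact: measurable_feasible.
    apply: measurable_fun_eqe; last exact: measurable_min_length.
    by apply/measurable_EFinP; exact: measurable_weight.
  exact: (mo measurableT [set false]).
apply/seteqP; split => omega /=.
  move=> h p _; have := h p.
  case: (boolP (optimal (fun e => w e omega) (fun e => c e omega) c0 p)) => [_ /(_ isT)|/negPf]; by [right|left].
by move=> h p op; case: (h p Logic.I) => //=; rewrite op.
Qed.

End MeasurableEvent.

(** * Moment estimates *)

Section ExpBounds.
Variable R : realType.
Implicit Types (x y l sigma : R).

Lemma sum_exp_coeff_le n x : 0 <= x -> \sum_(k < n) x ^+ k / k`!%:R <= expR x.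
Proof.
move=> x0; rewrite -(big_mkord xpredT (fun k => x ^+ k / k`!%:R)).
apply: (@nondecreasing_cvgn_le _ (series (exp_coeff x)) _ _ n).
  by apply: nondecreasing_series => k _ _; exact: exp_coeff_ge0.
exact: is_cvg_series_exp_coeff.
Qed.

Lemma entropy_lt1 sigma : 0 < sigma -> sigma != 1 -> sigma * (1 - ln sigma) < 1.
Proof.
move=> s0 s1; have : 1 + - ln sigma < expR (- ln sigma).
  by rewrite expR_gt1Dx // oppr_eq0 ln_eq0.
rewrite expRN lnK ?posrE // => h.
by rewrite -ltr_pdivlMl // mulr1.
Qed.

Lemma expR1_le_powS k : expR 1 * k.+1%:R ^+ k.+2 <= k.+2%:R ^+ k.+2 :> R.
Proof.
have k1 : 0 < k.+1%:R :> R by rewrite ltr0n.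
have k2 : 0 < k.+2%:R :> R by rewrite ltr0n.
have : 1 - k.+2%:R^-1 <= expR (- k.+2%:R^-1) :> R by exact: expR_ge1Dx.
rewrite (_ : 1 - _ = k.+1%:R / k.+2%:R); last first.
  have aux (x : R) : x + 1 != 0 -> 1 - (x + 1)^-1 = x / (x + 1) by move=> ?; field.
  by rewrite -[k.+2%:R]natr1 aux // natr1 gt_eqF.
rewrite expRN => h; have {}h : expR k.+2%:R^-1 * (k.+1%:R / k.+2%:R) <= 1 :> R.
  by rewrite -ler_pdivlMl ?expR_gt0 // mulr1.
have : (expR k.+2%:R^-1 * (k.+1%:R / k.+2%:R)) ^+ k.+2 <= 1 :> R.
  by rewrite exprn_ile1 // mulr_ge0 ?expR_ge0 // divr_ge0.
rewrite exprMn -expRM_natr mulVf ?gt_eqF // expr_div_n mulrA.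
by rewrite ler_pdivrMr ?exprn_gt0 // mul1r.
Qed.

Lemma fact_mul_expR_le k : (k.+1)`!%:R * expR k.+1%:R <= expR 1 * k.+1%:R ^+ k.+2 :> R.
Proof.
elim: k => [|k IHk]; first by rewrite factS fact0 mul1r expr1n mulr1.
rewrite factS natrM -[in expR _](addn1 k.+1) natrD expRD.
rewrite [leLHS](_ : _ = k.+2%:R * expR 1 * (k.+1`!%:R * expR k.+1%:R)); last by ring.
apply: (@le_trans _ _ (k.+2%:R * expR 1 * (expR 1 * k.+1%:R ^+ k.+2))).
  by rewrite ler_wpM2l // mulr_ge0 // expR_ge0.
by rewrite exprS [leRHS]mulrA [X in _ <= X * _]mulrC ler_wpM2l ?expR1_le_powS //.
Qed.

(* On Q the factor sigma ^ (k - sigma * l) is at least 1. *)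
Lemma tilted_sum_le n (Q : pred nat) l y sigma : 0 < sigma -> 0 <= y -> 0 <= l ->
  (forall k, Q k -> sigma * l * ln sigma <= k%:R * ln sigma) ->
  \sum_(k < n | Q k) (y * l) ^+ k / k`!%:R <= expR (l * (sigma * (y - ln sigma))).
Proof.
move=> s0 y0 l0 Qs.
apply: (@le_trans _ _ (expR (- (sigma * l * ln sigma)) *
    \sum_(k < n) (sigma * (y * l)) ^+ k / k`!%:R)); last first.
  rewrite (_ : l * _ = - (sigma * l * ln sigma) + sigma * (y * l)); last by ring.
  by rewrite expRD ler_wpM2l ?expR_ge0 // sum_exp_coeff_le // !mulr_ge0 // ltW.
rewrite mulr_sumr big_mkcond; apply: ler_sum => k _; case: ifP => [Qk|_]; last first.
  by rewrite mulr_ge0 ?expR_ge0 // divr_ge0 // exprn_ge0 // !mulr_ge0 // ltW.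
have e : sigma ^+ k = expR (k%:R * ln sigma) by rewrite expRM_natl lnK.
rewrite [(sigma * _) ^+ k]exprMn e [leRHS](_ : _ = expR (- (sigma * l * ln sigma) + k%:R * ln sigma) *
  ((y * l) ^+ k / k`!%:R)); last by rewrite expRD; ring.
rewrite -[leLHS]mul1r ler_wpM2r //; first by rewrite divr_ge0 // exprn_ge0 // mulr_ge0.
by rewrite -[leLHS]expR0 ler_expR addrC subr_ge0 Qs.
Qed.

End ExpBounds.

Section SimplexBounds.
Variables (R : realFieldType) (m : nat).
Local Notation sp := (simplex_prob R m).
Local Notation M := (m.+1%:R : R).

Lemma ffact_le_exp a k : (a ^_ k <= a ^ k)%N.
Proof.
elim: k a => // k IHk a; rewrite ffactnSr expnSr leq_mul // leq_subr //.
Qed.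

Lemma ffact_ge_exp a k j : (a + k <= j.+1)%N -> (a ^ k <= j ^_ k)%N.
Proof.
elim: k j => // k IHk j aj; rewrite ffactnSr expnSr leq_mul //; last by lia.
by apply: IHk; lia.
Qed.

Lemma simplex_prob_le k n s : (k <= n)%N -> sp k s <= ((s + n)%:R / M) ^+ k / k`!%:R.
Proof.
move=> kn; have f0 : 0 < k`!%:R :> R by rewrite ltr0n fact_gt0.
rewrite ler_pdivlMr // /simplex_prob mulrAC expr_div_n -natrM bin_ffact.
rewrite ler_wpM2r ?invr_ge0 ?exprn_ge0 // -natrX ler_nat.
apply: leq_trans (ffact_le_exp _ _) _.
by case: (k) kn => // j jn; rewrite leq_exp2r // leq_add2l.
Qed.

Lemma simplex_prob_ge k s : (s%:R / M) ^+ k / k`!%:R <= sp k s.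
Proof.
have f0 : 0 < k`!%:R :> R by rewrite ltr0n fact_gt0.
rewrite ler_pdivrMr // /simplex_prob mulrAC expr_div_n -natrM bin_ffact.
by rewrite ler_wpM2r ?invr_ge0 ?exprn_ge0 // -natrX ler_nat ffact_ge_exp // leqW.
Qed.

End SimplexBounds.

Lemma first_moment_bound (R : realType) n (n2 : (1 < n)%N) m s t (Q : pred nat) (kappa y sigma l : R) :
  0 < sigma -> 0 <= y -> 0 <= l -> n%:R = expR (2 * l) ->
  n%:R * (((s + n)%:R / m.+1%:R) * ((t + n)%:R / m.+1%:R)) <= (y * l) ^+ 2 ->
  (forall k, Q k -> sigma * l * ln sigma <= k%:R * ln sigma) ->
  sigma * (y - ln sigma) <= 1 - kappa ->
  Ex (fun a : {ffun edge n + edge n -> 'I_m.+1} =>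
    [exists p : {bseq n of 'I_n},
       [&& path12 p, Q #|path_edges p| & budget (path_edges p) s t a]]%:R)
  <= expR (- (2 * kappa * l)).
Proof.
move=> s0 y0 l0 nE uv Qs sy; apply: le_trans (first_moment R n2 m s t Q) _.
set u := (s + n)%:R / _ in uv; set v := (t + n)%:R / _ in uv.
have n0 : 0 < n%:R :> R by rewrite ltr0n ltnW.
have u0 : 0 <= u by rewrite divr_ge0.
have v0 : 0 <= v by rewrite divr_ge0.
pose T := \sum_(k < n | Q k) (y * l) ^+ k / k`!%:R.
have T0 : 0 <= T by apply: sumr_ge0 => k _; rewrite divr_ge0 // exprn_ge0 // mulr_ge0.
apply: (@le_trans _ _ (T ^+ 2 / n%:R)); last first.
  have h : T <= expR (l * (1 - kappa)).
    apply: le_trans (tilted_sum_le n s0 y0 l0 Qs) _.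
    by rewrite ler_expR ler_wpM2l.
  rewrite nE ler_pdivrMr ?expR_gt0 // -expRD.
  apply: (@le_trans _ _ (expR (l * (1 - kappa)) ^+ 2)); first by rewrite ler_sqr ?nnegrE ?expR_ge0.
  by rewrite -expRM_natr ler_expR le_eqVlt; apply/orP; left; apply/eqP; ring.
rewrite expr2 {1}/T mulr_suml mulr_suml big_mkcond [leRHS]big_mkcond /=.
have a0 i : 0 <= (y * l) ^+ i / i`!%:R by rewrite divr_ge0 // exprn_ge0 // mulr_ge0.
apply: ler_sum => k _; case: (boolP (Q k)) => Qk; rewrite ?andbT ?andbF //.
case: ifP => k0; last by rewrite divr_ge0 // mulr_ge0.
apply: (@le_trans _ _ (((y * l) ^+ k / k`!%:R) * ((y * l) ^+ k / k`!%:R) / n%:R)); last first.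
  rewrite ler_wpM2r ?invr_ge0 // ler_wpM2l // /T (bigD1 k) //= lerDl.
  exact: sumr_ge0.
have kn := ltnW (ltn_ord k).
have h : simplex_prob R m k s * simplex_prob R m k t <= (u * v) ^+ k / (k`!%:R * k`!%:R).
  rewrite exprMn invfM [leRHS]mulrACA; apply: ler_pM; rewrite ?simplex_prob_ge0 //; exact: simplex_prob_le.
apply: le_trans (ler_wpM2l (exprn_ge0 _ (ltW n0)) h) _.
have -> : n%:R ^+ k.-1 = n%:R ^+ k / n%:R :> R.
  by case: (val k) k0 => // j _; rewrite /= exprSr mulfK // gt_eqF.
have aux1 (a b c e : R) : a / c * (b * e) = (a * b) * (e / c) by ring.
have aux2 (z f c : R) : z * f * (z * f) / c = (z * z) * (f * f / c) by ring.
have e1 : (y * l) ^+ k * (y * l) ^+ k = ((y * l) ^+ 2) ^+ k by rewrite -expr2 exprAC.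
have e2 : n%:R ^+ k * (u * v) ^+ k = (n%:R * (u * v)) ^+ k by rewrite [RHS]exprMn.
rewrite [leLHS]aux1 [leRHS]aux2 e1 e2 !invfM.
by rewrite ler_wpM2r ?invr_ge0 ?mulr_ge0 // ?invr_ge0 // lerXn2r ?nnegrE ?exprn_ge0 ?mulr_ge0.
Qed.

Section SecondMomentBound.
Variables (R : realType) (n m s t s1 t1 k : nat) (n2 : (1 < n)%N).
Variables (l delta rho K : R).
Hypotheses (sm : (s <= m)%N) (tm : (t <= m)%N) (s1m : (s1 <= m)%N) (t1m : (t1 <= m)%N).
Hypotheses (k0 : (0 < k)%N) (s0 : (0 < s)%N) (t0 : (0 < t)%N) (kn : (k + 2 < n)%N).
Hypotheses (l0 : 0 < l) (nE : n%:R = expR (2 * l)) (kl : k%:R <= l) (lk : l <= k.+1%:R).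
Hypotheses (delta0 : 0 < delta) (rho0 : 0 <= rho) (rho1 : rho <= 1) (K0 : 0 <= K)
  (rhoK : 1 + rho * K <= K).
Local Notation M := (m.+1%:R : R).
Hypothesis st_ge : l ^+ 2 <= rho * (n%:R * (s%:R / M * (t%:R / M))).
Hypothesis st1_ge : (delta * l) ^+ 2 <= n%:R * (s1.+1%:R / M * (t1.+1%:R / M)).

Local Notation D := (n%:R - (k + 2)%:R : R).

Definition growth_ratio : R := ((n%:R + 2 * K * k.+1%:R) / D) ^+ k.+1.

Let n0 : 0 < n%:R :> R. Proof. by rewrite ltr0n ltnW. Qed.
Let M0 : 0 < M. Proof. by rewrite ltr0n. Qed.
Let D0 : 0 < D. Proof. by rewrite subr_gt0 ltr_nat. Qed.
Let k0' : 0 < k%:R :> R. Proof. by rewrite ltr0n. Qed.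
Let sR : 0 < s%:R :> R. Proof. by rewrite ltr0n. Qed.
Let tR : 0 < t%:R :> R. Proof. by rewrite ltr0n. Qed.

Let theta_le : theta R m s t k <= rho * n%:R.
Proof.
rewrite /theta (_ : _ * _ = (k%:R ^+ 2) / (s%:R / M * (t%:R / M))); last first.
  by field; rewrite !gt_eqF.
rewrite ler_pdivrMr; last by rewrite mulr_gt0 // divr_gt0.
rewrite -(mulrA rho) (le_trans _ st_ge) // lerXn2r ?nnegrE // ltW //.
Qed.

Let q1E : simplex_prob R m 1 s1 * simplex_prob R m 1 t1 = s1.+1%:R / M * (t1.+1%:R / M).
Proof. by rewrite !simplex_prob1. Qed.

Let q1_inv : (simplex_prob R m 1 s1 * simplex_prob R m 1 t1)^-1 <= ((delta * l) ^+ 2)^-1 * n%:R.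
Proof.
have dl : 0 < (delta * l) ^+ 2 by rewrite exprn_gt0 // mulr_gt0.
rewrite q1E -[leLHS]mul1r ler_pdivrMr; last by rewrite mulr_gt0 // divr_gt0 // ltr0n.
by rewrite -[leRHS]mulrA ler_pdivlMl // mulr1.
Qed.

Lemma pow_div_fact_ge : n%:R / (expR 4 * l ^+ 2) <= (k%:R ^+ k / k`!%:R) ^+ 2 :> R.
Proof.
have f0 : 0 < k`!%:R :> R by rewrite ltr0n fact_gt0.
have h : expR k%:R / (expR 1 * k%:R) <= k%:R ^+ k / k`!%:R :> R.
  rewrite ler_pdivrMr ?mulr_gt0 ?expR_gt0 // mulrAC ler_pdivlMr //.
  rewrite mulrC [leRHS]mulrCA -exprSr.
  by case: (k) k0 => // j _; exact: fact_mul_expR_le.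
apply: (@le_trans _ _ ((expR k%:R / (expR 1 * k%:R)) ^+ 2)); last first.
  by rewrite lerXn2r ?nnegrE // ?divr_ge0 ?mulr_ge0 ?expR_ge0 ?exprn_ge0.
rewrite expr_div_n exprMn -!expRM_natr nE.
rewrite ler_pdivrMr; last by rewrite mulr_gt0 ?expR_gt0 ?exprn_gt0.
rewrite mulrAC ler_pdivlMr; last by rewrite mulr_gt0 ?expR_gt0 ?exprn_gt0.
have -> : expR (4 : R) = expR (1 * 2) * expR 2.
  by rewrite -expRD; congr expR; lra.
have h1 : expR (2 * l) <= expR (k%:R * 2) * expR 2.
  by rewrite -expRD ler_expR; move: lk; rewrite -natr1; lra.
have h2 : k%:R ^+ 2 <= l ^+ 2 by rewrite lerXn2r ?nnegrE // ltW.
rewrite [leLHS]mulrCA [leRHS](_ : _ = expR (1 * 2) * ((expR (k%:R * 2) * expR 2) * l ^+ 2)); last by ring.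
rewrite ler_pM2l ?expR_gt0 //; apply: ler_pM => //; rewrite ?expR_ge0 ?exprn_ge0 //.
Qed.

Lemma second_moment_bound :
  Ex (fun a : {ffun edge n + edge n -> 'I_m.+1} =>
    (~~ [exists v in [set v : k.+1.-tuple 'I_n | interior n2 v],
        good n2 s t s1 t1 v a])%:R)
  <= growth_ratio * (expR 4 / (delta ^+ 4 * l ^+ 2)) +
     (1 + ((delta * l) ^+ 2)^-1 * K) ^+ 2 * growth_ratio - 1.
Proof.
have dl : 0 < (delta * l) ^+ 2 by rewrite exprn_gt0 // mulr_gt0.
have N0D : D ^+ k.+1 <= #|[set v : k.+1.-tuple 'I_n | interior n2 v]|%:R :> R.
  rewrite card_paths -natrB; last by rewrite ltnW.
  by rewrite -natrX ler_nat; apply: ffact_ge_exp; move: kn; clear; lia.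
have N0 : (0 < #|[set v : k.+1.-tuple 'I_n | interior n2 v]|)%N.
  by rewrite -(ltr0n R) (lt_le_trans _ N0D) // exprn_gt0.
apply: le_trans (@second_moment R n n2 m s t s1 t1 k sm tm s1m t1m k0 s0 t0 rho K
  ((delta * l) ^+ 2)^-1 rho0 K0 rhoK theta_le _ q1_inv N0) _.
  by rewrite invr_ge0 ltW.
set N := #|_|%:R in N0D *; have NR : 0 < N by rewrite /N ltr0n.
have Dk : 0 < D ^+ k.+1 by rewrite exprn_gt0.
rewrite lerD2r; apply: lerD; last first.
  rewrite /overlap_bound -mulrA ler_wpM2l ?sqr_ge0 // /growth_ratio expr_div_n.
  rewrite ler_wpM2l ?exprn_ge0 ?addr_ge0 ?mulr_ge0 // ?(ltW n0) //.
  by rewrite lef_pV2.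
have gr : (n%:R / D) ^+ k.+1 <= growth_ratio.
  rewrite /growth_ratio; have : 0 < D := D0; move: (D) => X X0.
  have nX : n%:R / X <= (n%:R + 2 * K * k.+1%:R) / X.
    by rewrite ler_wpM2r ?invr_ge0 ?(ltW X0) // lerDl !mulr_ge0.
  rewrite lerXn2r ?nnegrE //; last apply: le_trans nX; by rewrite divr_ge0 // ltW.
apply: (@le_trans _ _ ((n%:R / D) ^+ k.+1 * (expR 4 / (delta ^+ 4 * l ^+ 2)))); last first.
  by rewrite ler_wpM2r // divr_ge0 ?expR_ge0 // mulr_ge0 // exprn_ge0 // ltW.
set p := simplex_prob R m k s * simplex_prob R m k t.
set q := simplex_prob R m 1 s1 * simplex_prob R m 1 t1.
have -> : path_prob R m s t s1 t1 k = q * p * q by [].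
have q_ge : (delta * l) ^+ 2 / n%:R <= q by rewrite /q q1E ler_pdivrMr // [leRHS]mulrC.
have st_ge' : l ^+ 2 / n%:R <= s%:R / M * (t%:R / M).
  rewrite ler_pdivrMr // [leRHS]mulrC (le_trans st_ge) // ler_piMl // !mulr_ge0.
have p_ge : (k%:R ^+ 2 / n%:R) ^+ k / k`!%:R ^+ 2 <= p.
  apply: (@le_trans _ _ ((s%:R / M * (t%:R / M)) ^+ k / k`!%:R ^+ 2)).
    rewrite ler_wpM2r ?invr_ge0 ?exprn_ge0 //; apply: lerXn2r; rewrite ?nnegrE.
    - by rewrite divr_ge0 // exprn_ge0.
    - by rewrite mulr_ge0 // divr_ge0.
    - apply: le_trans st_ge'; rewrite ler_wpM2r ?invr_ge0 // lerXn2r ?nnegrE // ltW //.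
  rewrite exprMn expr2 invfM [leLHS]mulrACA.
  by apply: ler_pM; rewrite ?simplex_prob_ge //; rewrite divr_ge0 // exprn_ge0 // divr_ge0.
have e1 : (k%:R ^+ 2 / n%:R) ^+ k / k`!%:R ^+ 2 = (k%:R ^+ k / k`!%:R) ^+ 2 / n%:R ^+ k :> R.
  by rewrite expr_div_n exprAC [in RHS]expr_div_n mulrAC.
have p_ge' : n%:R / (expR 4 * l ^+ 2) / n%:R ^+ k <= p.
  apply: le_trans p_ge; rewrite e1 ler_wpM2r ?invr_ge0 ?exprn_ge0 //.
  exact: pow_div_fact_ge.
have q0 : 0 <= (delta * l) ^+ 2 / n%:R by rewrite divr_ge0 // ltW.
have p0 : 0 <= n%:R / (expR 4 * l ^+ 2) / n%:R ^+ k.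
  apply: divr_ge0; last by rewrite exprn_ge0.
  by apply: divr_ge0 => //; apply: mulr_ge0; [exact: expR_ge0|exact: sqr_ge0].
have h : (D / n%:R) ^+ k.+1 * (delta ^+ 4 * l ^+ 2 / expR 4) <= N * (q * p * q).
  apply: (@le_trans _ _ (D ^+ k.+1 * (((delta * l) ^+ 2 / n%:R) *
    (n%:R / (expR 4 * l ^+ 2) / n%:R ^+ k) * ((delta * l) ^+ 2 / n%:R)))).
    rewrite le_eqVlt; apply/orP; left; apply/eqP.
    rewrite expr_div_n [in n%:R ^+ k.+1]exprS.
    have nk : n%:R ^+ k != 0 :> R by rewrite expf_neq0 // gt_eqF.
    move: (n%:R ^+ k) nk (D ^+ k.+1) => X X0 Y.
    by field; rewrite X0 !gt_eqF ?expR_gt0.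
  apply: ler_pM => //; first exact: ltW.
    exact: mulr_ge0 (mulr_ge0 q0 p0) q0.
  by apply: ler_pM => //; [exact: mulr_ge0|exact: ler_pM].
have pos : 0 < (D / n%:R) ^+ k.+1 * (delta ^+ 4 * l ^+ 2 / expR 4).
  by rewrite mulr_gt0 ?exprn_gt0 ?divr_gt0 ?mulr_gt0 ?exprn_gt0 ?expR_gt0.
apply: (@le_trans _ _ ((D / n%:R) ^+ k.+1 * (delta ^+ 4 * l ^+ 2 / expR 4))^-1).
  by rewrite lef_pV2 ?posrE // (lt_le_trans pos).
by rewrite invfM -exprVn !invf_div.
Qed.

End SecondMomentBound.

Lemma rel_close_fin (R : realType) (eps r b : R) : 0 < b ->
  rel_close eps r%:E b <-> (1 - eps) * b <= r <= (1 + eps) * b.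
Proof.
move=> b0; rewrite /rel_close -EFinM -EFinB abse_EFin lee_fin ler_distl.
by rewrite ler_pdivlMr // ler_pdivrMr //; split.
Qed.

Lemma event_of_bounds (R : realType) n (wv cv : edge n -> R) (c0 eps eps1 b l : R) :
  0 < b -> 0 < l -> eps1 <= eps ->
  (exists2 p, feasible cv c0 p & weight wv p <= (1 + eps1) * b) ->
  (forall p, feasible cv c0 p -> (1 - eps) * b <= weight wv p) ->
  (forall p, feasible cv c0 p -> weight wv p <= (1 + eps1) * b ->
     (1 - eps) * l <= #|path_edges p|%:R <= (1 + eps) * l) ->
  rel_close eps (min_length wv cv c0) b
  /\ forall p : {bseq n of 'I_n}, optimal wv cv c0 p ->
     rel_close eps (#|path_edges p|%:R%:E) l.
Proof.
move=> b0 l0 e1 [p0 fp0 wp0] lb ln.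
have ub : (min_length wv cv c0 <= ((1 + eps1) * b)%:E)%E.
  by apply: le_trans (bigmin_le_cond _ _ fp0) _; rewrite lee_fin.
have {}lb : (((1 - eps) * b)%:E <= min_length wv cv c0)%E.
  by apply/bigmin_geP; split=> [|p fp]; [rewrite leey|rewrite lee_fin; exact: lb].
split.
  move: (min_length wv cv c0) lb ub => [r| |] //=; rewrite !lee_fin => h1 h2.
  apply/rel_close_fin => //; rewrite h1 /= (le_trans h2) // ler_pM2r //; lra.
move=> p /andP[fp /eqP wp]; apply/rel_close_fin => //; apply: ln => //.
by rewrite -lee_fin wp.
Qed.

Section CellSum.
Context d (T : measurableType d) (R : realType) (P : probability T R).
Variables (I : finType) (X : I -> {RV P >-> R}) (m : nat).

Lemma cell_sum (J : finType) (f : J -> I) (S : {set J}) (a : {ffun I -> 'I_m.+1}) omega :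
  cell X a omega ->
  (\sum_(j in S) a (f j))%:R / m.+1%:R <= \sum_(j in S) X (f j) omega
  <= ((\sum_(j in S) a (f j)) + #|S|)%:R / m.+1%:R.
Proof.
move=> ca; have M0 : 0 < m.+1%:R :> R by rewrite ltr0n.
rewrite -sum1_card -big_split /= !natr_sum !mulr_suml.
apply/andP; split; apply: ler_sum => j _; have := ca (f j) Logic.I;
  rewrite /= in_itv /= => /andP[h1 h2] //.
by rewrite addn1 ltW.
Qed.

End CellSum.

Lemma truncn_add_le (R : realType) (x M : R) (n : nat) : 0 <= x -> 0 < M ->
  ((Num.truncn (x * M)) + n)%:R / M <= x + n%:R / M.
Proof.
move=> x0 M0; rewrite natrD mulrDl lerD2r ler_pdivrMr //.
by rewrite truncn_le mulr_ge0 // ltW.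
Qed.

Section CellPaths.
Context d (T : measurableType d) (R : realType) (P : probability T R).
Variables (n : nat) (n2 : (1 < n)%N) (w c : edge n -> {RV P >-> R}) (m : nat).
Variables (a : {ffun edge n + edge n -> 'I_m.+1}) (omega : T).
Hypothesis cell_a : cell (join_edges w c) a omega.
Local Notation M := (m.+1%:R : R).
Let wv e := w e omega.
Let cv e := c e omega.

Let M0 : 0 < M. Proof. by rewrite ltr0n. Qed.

Lemma budget_of_weights (p : {bseq n of 'I_n}) (x z : R) : 0 <= x -> 0 <= z ->
  weight wv p <= x -> weight cv p <= z ->
  budget (path_edges p) (Num.truncn (x * M)) (Num.truncn (z * M)) a.
Proof.
move=> x0 z0 wx cz; apply/andP; split.
  have /andP[h _] := @cell_sum _ T R P _ (join_edges w c) m _ inl (path_edges p) a omega cell_a.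
  rewrite truncn_ge_nat ?mulr_ge0 // -ler_pdivrMr //.
  exact: le_trans h wx.
have /andP[h _] := @cell_sum _ T R P _ (join_edges w c) m _ inr (path_edges p) a omega cell_a.
rewrite truncn_ge_nat ?mulr_ge0 // -ler_pdivrMr //.
exact: le_trans h cz.
Qed.

Variables (k s t s1 t1 : nat).

Lemma feasible_of_good (v : seq 'I_n) (x z : R) : size v = k.+1 -> interior n2 v ->
  good n2 s t s1 t1 v a ->
  (s1 + s + s1 + (k + 2))%:R / M <= x -> (t1 + t + t1 + (k + 2))%:R / M <= z ->
  exists2 p, feasible cv z p & weight wv p <= x.
Proof.
move=> sv iv gv sx tz.
have [d12 d13 d23 [c1 c2 c3]] := interior_edges sv iv.
pose l := v0 n2 :: rcons v (v1 n2).
have sl : (size l <= n)%N.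
  by rewrite -(card_uniqP iv) -[leqRHS]card_ord max_card.
pose p : {bseq n of 'I_n} := insub_bseq n l.
have pE : bseqval p = l.
  by rewrite /p /insub_bseq val_insubd sl.
have pp : path12 p.
  by rewrite /path12 pE /= last_rcons !eqxx andbT.
have eE : path_edges p = all_edges n2 v.
  by rewrite (path_edgesE pE) all_edgesE // sv.
have d123 : [disjoint first_edge n2 v :|: middle_edges n2 v & last_edge n2 v].
  by rewrite -finset.setI_eq0 finset.setIUl; move: d13 d23;
    rewrite -!finset.setI_eq0 => /eqP -> /eqP ->; rewrite finset.setU0.
have cE : #|path_edges p| = (k + 2)%N.
  by have [-> _] := card_path_edges n2 pp; rewrite pE /l /= size_rcons sv addn2.
have sumE (f : edge n -> nat) : (\sum_(e in path_edges p) f e =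
    \sum_(e in first_edge n2 v) f e + \sum_(e in middle_edges n2 v) f e +
    \sum_(e in last_edge n2 v) f e)%N.
  rewrite eE -(bigU _ _ _ d12) -(bigU _ _ _ _); first by apply: eq_bigl => e; rewrite !inE.
  by apply/pred0P => e; have := (pred0P d123) e; rewrite /= !inE.
case/and3P: gv => /andP[f1 f2] /andP[g1 g2] /andP[h1 h2].
exists p.
  rewrite /feasible pp /=; apply: le_trans tz.
  have /andP[_ h] := @cell_sum _ T R P _ (join_edges w c) m _ inr (path_edges p) a omega cell_a.
  apply: le_trans h _; rewrite ler_pM2r ?invr_gt0 // ler_nat cE sumE.
  by rewrite leq_add2r !leq_add.
apply: le_trans sx.
have /andP[_ h] := @cell_sum _ T R P _ (join_edges w c) m _ inl (path_edges p) a omega cell_a.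
apply: le_trans h _; rewrite ler_pM2r ?invr_gt0 // ler_nat cE sumE.
by rewrite leq_add2r !leq_add.
Qed.

End CellPaths.

Section EventProb.
Context d (T : measurableType d) (R : realType) (P : probability T R).
Variables (n : nat) (n2 : (1 < n)%N) (w c : edge n -> {RV P >-> R}).
Hypotheses (w_unif : forall e, uniform01 (w e)) (c_unif : forall e, uniform01 (c e)).
Hypothesis wc_indep : mutually_independent (join_edges w c).
Variables (eps eps1 tau delta rho K kappa y1 y2 : R).
Hypotheses (eps_gt0 : 0 < eps) (eps_lt1 : eps < 1) (eps1_gt0 : 0 < eps1) (eps1_le : eps1 <= eps).
Hypotheses (tau_gt0 : 0 < tau) (tau_le : tau <= delta) (delta4 : 4 * delta < 1).
Hypotheses (rho_ge0 : 0 <= rho) (rho_le1 : rho <= 1) (K_ge0 : 0 <= K) (rhoK : 1 + rho * K <= K).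
Hypothesis rhoE : 1 <= rho * ((1 - 4 * delta) ^+ 2 * (1 + eps1)).
Hypotheses (y1_ge0 : 0 <= y1) (y2_ge0 : 0 <= y2).
Hypothesis y1_le : y1 <= 1 - kappa.
Hypothesis y1_sqr : (1 - eps + tau) * (1 + tau) <= y1 ^+ 2.
Hypothesis y2_sqr : (1 + eps1 + tau) * (1 + tau) <= y2 ^+ 2.
Hypothesis y2_high : (1 + eps) * (y2 - ln (1 + eps)) <= 1 - kappa.
Hypothesis y2_low : (1 - eps) * (y2 - ln (1 - eps)) <= 1 - kappa.
Variables (k : nat) (l b c0 : R).
Hypotheses (k_gt0 : (0 < k)%N) (kn : (k + 2 < n)%N) (l_gt0 : 0 < l) (nE : n%:R = expR (2 * l)).
Hypotheses (kl : k%:R <= l) (lk : l <= k.+1%:R).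
Hypotheses (b_gt0 : 0 < b) (c0_gt0 : 0 < c0) (bc : n%:R * (b * c0) = l ^+ 2).
Hypotheses (b_lt1 : (1 + eps1) * b <= 1) (c0_lt1 : c0 <= 1).

Let n0 : 0 < n%:R :> R. Proof. by rewrite ltr0n ltnW. Qed.
Let delta_gt0 : 0 < delta. Proof. exact: lt_le_trans tau_le. Qed.

Definition failure_bound : R :=
  3 * expR (- (2 * kappa * l)) +
  (growth_ratio n k K * (expR 4 / (delta ^+ 4 * l ^+ 2)) +
     (1 + ((delta * l) ^+ 2)^-1 * K) ^+ 2 * growth_ratio n k K - 1).

Let mesh_exists : exists m : nat,
  n%:R / m.+1%:R <= tau * b /\ n%:R / m.+1%:R <= tau * c0.
Proof.
have t1 : 0 < tau * b by rewrite mulr_gt0.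
have t2 : 0 < tau * c0 by rewrite mulr_gt0.
pose x := n%:R / (tau * b) + n%:R / (tau * c0).
have x1 : 0 <= n%:R / (tau * b) by rewrite divr_ge0 // ltW.
have x2 : 0 <= n%:R / (tau * c0) by rewrite divr_ge0 // ltW.
have x0 : 0 <= x by rewrite addr_ge0.
exists (Num.truncn x); have /andP[_ /ltW h] := truncn_itv x0.
have M0 : 0 < (Num.truncn x).+1%:R :> R by rewrite ltr0n.
split; rewrite ler_pdivrMr // [leRHS]mulrC -ler_pdivrMr //; apply: le_trans h.
  by rewrite lerDl.
by rewrite lerDr.
Qed.

Section Mesh.
Variable m : nat.
Local Notation M := (m.+1%:R : R).
Hypotheses (mb : n%:R / M <= tau * b) (mc : n%:R / M <= tau * c0).
Let M0 : 0 < M. Proof. by rewrite ltr0n. Qed.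
Local Notation tr x := (Num.truncn (x * M)).
Local Notation Omega := {ffun edge n + edge n -> 'I_m.+1}.

Definition short_path (Q : pred nat) (x : R) (a : Omega) : bool :=
  [exists p : {bseq n of 'I_n},
    [&& path12 p, Q #|path_edges p| & budget (path_edges p) (tr x) (tr c0) a]].

Lemma Ex_short_path (Q : pred nat) (x y sigma : R) : 0 <= x -> 0 < sigma -> 0 <= y ->
  (x + tau) * (1 + tau) <= y ^+ 2 ->
  (forall k, Q k -> sigma * l * ln sigma <= k%:R * ln sigma) ->
  sigma * (y - ln sigma) <= 1 - kappa ->
  Ex (fun a => (short_path Q (x * b) a)%:R) <= expR (- (2 * kappa * l)).
Proof.
move=> x0 sigma0 y0 xy Qs sy; apply: (@first_moment_bound R n n2 m _ _ Q kappa y sigma l) => //.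
  exact: ltW.
have xb : 0 <= x * b by rewrite mulr_ge0 // ltW.
apply: (@le_trans _ _ (n%:R * (((x + tau) * b) * ((1 + tau) * c0)))).
  rewrite ler_wpM2l //; apply: ler_pM; rewrite ?divr_ge0 //.
    by apply: le_trans (truncn_add_le n xb M0) _; rewrite mulrDl lerD2l.
  by apply: le_trans (truncn_add_le n (ltW c0_gt0) M0) _; rewrite mulrDl mul1r lerD2l.
rewrite [leLHS](_ : _ = ((x + tau) * (1 + tau)) * (n%:R * (b * c0))); last by ring.
by rewrite bc exprMn ler_wpM2r // sqr_ge0.
Qed.

Let L := (1 + eps1) * b.
Let s1 := tr (delta * L).
Let s := tr ((1 - 3 * delta) * L).
Let t1 := tr (delta * c0).
Let t := tr ((1 - 3 * delta) * c0).

Definition connected (a : Omega) : bool :=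
  [exists v in [set v : k.+1.-tuple 'I_n | interior n2 v], good n2 s t s1 t1 v a].

Let d3 : 0 < 1 - 3 * delta.
Proof. by rewrite subr_gt0; move: delta4 delta_gt0; lra. Qed.

Let L_gt0 : 0 < L. Proof. by rewrite mulr_gt0 // addr_gt0. Qed.

Let mesh_delta x z : z <= x -> 0 < x -> n%:R / M <= tau * z -> n%:R <= delta * x * M.
Proof.
move=> zx x0 h; rewrite -ler_pdivrMr //; apply: le_trans h _.
apply: (@le_trans _ _ (tau * x)); first by rewrite ler_wpM2l // ltW.
by rewrite ler_wpM2r // ltW.
Qed.

Let bL : b <= L. Proof. by rewrite /L mulrDl mul1r lerDl mulr_ge0 // ltW. Qed.
Let nL : n%:R <= delta * L * M. Proof. exact: mesh_delta bL L_gt0 mb. Qed.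
Let nc : n%:R <= delta * c0 * M. Proof. exact: mesh_delta (lexx _) c0_gt0 mc. Qed.

Let tr_le x : 0 < x -> (tr x)%:R / M <= x.
Proof. by move=> x0; rewrite ler_pdivrMr // truncn_le mulr_ge0 // ltW. Qed.

Let tr_lem x : 0 < x -> x < 1 -> (tr x <= m)%N.
Proof.
move=> x0 x1; rewrite -ltnS truncn_lt_nat; last by rewrite mulr_ge0 // ltW.
by rewrite gtr_pMl.
Qed.

Let tr_ge x : 0 < x -> n%:R <= delta * x * M ->
  (1 - 4 * delta) * x <= (tr ((1 - 3 * delta) * x))%:R / M /\
  delta * x <= (tr (delta * x)).+1%:R / M /\ (0 < tr ((1 - 3 * delta) * x))%N.
Proof.
move=> x0 h; have y0 : 0 <= (1 - 3 * delta) * x * M by rewrite !mulr_ge0 // ltW.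
have z0 : 0 <= delta * x * M by rewrite !mulr_ge0 // ltW.
have /andP[_ h1] := truncn_itv y0; have /andP[_ h2] := truncn_itv z0.
have h3 : 1 <= n%:R :> R by rewrite ler1n ltnW.
rewrite !ler_pdivlMr //; split; last split; last 1 first.
- rewrite truncn_gt0; apply: le_trans (le_trans h3 h) _.
  by rewrite !ler_wpM2r // ?ltW //; move: delta4; lra.
- by move: h1; rewrite -natr1 => h1; move: h3 h; nra.
- exact: ltW.
Qed.

Lemma Ex_not_connected :
  Ex (fun a => (~~ connected a)%:R) <=
  growth_ratio n k K * (expR 4 / (delta ^+ 4 * l ^+ 2)) +
     (1 + ((delta * l) ^+ 2)^-1 * K) ^+ 2 * growth_ratio n k K - 1.
Proof.
have [h1 [h2 h3]] := tr_ge L_gt0 nL; have [g1 [g2 g3]] := tr_ge c0_gt0 nc.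
have d1 x : 0 < x -> x <= 1 -> delta * x < 1.
  move=> x0 x1; apply: (@le_lt_trans _ _ delta); first by rewrite ler_piMr // ltW.
  by move: delta4 delta_gt0; lra.
have d2 x : 0 < x -> x <= 1 -> (1 - 3 * delta) * x < 1.
  move=> x0 x1; apply: (@le_lt_trans _ _ (1 - 3 * delta)).
    by rewrite ler_piMr // ltW.
  by move: delta_gt0; lra.
apply: (@second_moment_bound R n m s t s1 t1 k n2 l delta rho K) => //.
- by apply: tr_lem; [exact: mulr_gt0|exact: d2].
- by apply: tr_lem; [exact: mulr_gt0|exact: d2].
- by apply: tr_lem; [exact: mulr_gt0|exact: d1].
- by apply: tr_lem; [exact: mulr_gt0|exact: d1].
- apply: (@le_trans _ _ (rho * (n%:R * ((1 - 4 * delta) * L * ((1 - 4 * delta) * c0))))).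
    rewrite [leRHS](_ : _ = rho * ((1 - 4 * delta) ^+ 2 * (1 + eps1)) * l ^+ 2).
      by rewrite ler_peMl // sqr_ge0.
    by rewrite -bc /L; ring.
  have d4 : 0 <= 1 - 4 * delta by move: delta4; lra.
  by rewrite ler_wpM2l // ler_wpM2l //; apply: ler_pM => //; rewrite mulr_ge0 // ltW.
- apply: (@le_trans _ _ (n%:R * ((delta * L) * (delta * c0)))).
    rewrite [leRHS](_ : _ = (1 + eps1) * (delta * l) ^+ 2).
      by rewrite ler_peMl ?sqr_ge0 // lerDl ltW.
    by rewrite exprMn -bc /L; ring.
  by rewrite ler_wpM2l //; apply: ler_pM => //; rewrite mulr_ge0 // ltW.
Qed.


Lemma event_of_mesh (a : Omega) omega : cell (join_edges w c) a omega ->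
  ~~ short_path xpredT ((1 - eps) * b) a ->
  ~~ short_path (fun j => (1 + eps) * l < j%:R) L a ->
  ~~ short_path (fun j => j%:R < (1 - eps) * l) L a ->
  connected a ->
  rel_close eps (min_length (fun e => w e omega) (fun e => c e omega) c0) b
  /\ forall p : {bseq n of 'I_n},
    optimal (fun e => w e omega) (fun e => c e omega) c0 p ->
    rel_close eps (#|path_edges p|%:R%:E) l.
Proof.
move=> ca n1 nhi nlo /existsP[v /andP[+ gv]]; rewrite inE => iv.
have e0 : 0 <= (1 - eps) * b by rewrite mulr_ge0 ?(ltW b_gt0) // subr_ge0 ltW.
have nk : (k + 2)%:R / M <= n%:R / M by rewrite ler_pM2r ?invr_gt0 // ler_nat ltnW.
have tot x : 0 < x -> n%:R <= delta * x * M ->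
    (tr (delta * x) + tr ((1 - 3 * delta) * x) + tr (delta * x) + (k + 2))%:R / M <= x.
  move=> x0 nx; have h1 := tr_le (mulr_gt0 delta_gt0 x0); have h2 := tr_le (mulr_gt0 d3 x0).
  have h3 : n%:R / M <= delta * x by rewrite ler_pdivrMr.
  have e (A B C : nat) : (A + B + A + C)%:R / M = A%:R / M + B%:R / M + A%:R / M + C%:R / M.
    by rewrite !natrD !mulrDl.
  rewrite e; apply: (@le_trans _ _ (delta * x + (1 - 3 * delta) * x + delta * x + delta * x)).
    by rewrite !lerD // (le_trans nk).
  by rewrite le_eqVlt; apply/orP; left; apply/eqP; ring.
apply: (@event_of_bounds _ n _ _ _ eps eps1) => //.
- apply: (@feasible_of_good _ T R P n n2 w c m a omega ca k s t s1 t1 v) => //.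
  + by rewrite size_tuple.
  + exact: tot.
  + exact: tot.
- move=> p /andP[pp cp]; rewrite leNgt; apply/negP => /ltW wp; move/negP: n1; apply.
  apply/existsP; exists p; rewrite pp /=.
  exact: (@budget_of_weights _ T R P n w c m a omega ca p _ _ e0 (ltW c0_gt0)).
- move=> p /andP[pp cp] wp.
  have bw := @budget_of_weights _ T R P n w c m a omega ca p _ _ (ltW L_gt0) (ltW c0_gt0) wp cp.
  rewrite !leNgt; apply/andP; split; apply/negP => h.
    by move/negP: nlo; apply; apply/existsP; exists p; rewrite pp h.
  by move/negP: nhi; apply; apply/existsP; exists p; rewrite pp h.
Qed.

End Mesh.

Lemma event_prob_ge : ((1 - failure_bound)%:E <= P [set omega |
  rel_close eps (min_length (fun e => w e omega) (fun e => c e omega) c0) b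
  /\ forall p : {bseq n of 'I_n},
    optimal (fun e => w e omega) (fun e => c e omega) c0 p ->
    rel_close eps (#|path_edges p|%:R%:E) l]%classic)%E.
Proof.
have [m [mb mc]] := mesh_exists.
pose s1 := short_path (m := m) xpredT ((1 - eps) * b).
pose s2 := short_path (m := m) (fun j => (1 + eps) * l < j%:R) ((1 + eps1) * b).
pose s3 := short_path (m := m) (fun j => j%:R < (1 - eps) * l) ((1 + eps1) * b).
pose s4 a := ~~ connected (m := m) a.
apply: (@prob_ge_cells _ T R P _ (join_edges w c) m _ wc_indep
  (fun a => [|| s1 a, s2 a, s3 a | s4 a])).
- by case => e; [exact: w_unif|exact: c_unif].
- exact: measurable_close_event.
- move=> a; rewrite !negb_or /s4 negbK => /and4P[h1 h2 h3 h4] omega ca.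
  exact: (event_of_mesh mb mc ca).
apply: (@le_trans _ _ (Ex (fun a => (s1 a)%:R + (s2 a)%:R + (s3 a)%:R + (s4 a)%:R : R))).
  apply: le_Ex => a; case: (s1 a); case: (s2 a); case: (s3 a); case: (s4 a) => /=; lra.
rewrite !ExD /failure_bound; apply: lerD; last exact: Ex_not_connected.
have -> : 3 * expR (- (2 * kappa * l)) =
    expR (- (2 * kappa * l)) + expR (- (2 * kappa * l)) + expR (- (2 * kappa * l)) by ring.
apply: lerD; first apply: lerD.
- apply: (@Ex_short_path m mb mc _ _ y1 1) => //; first by rewrite subr_ge0 ltW.
  + by move=> j _; rewrite ln1 !mulr0.
  + by rewrite ln1 subr0 mul1r.
- apply: (@Ex_short_path m mb mc _ _ y2 (1 + eps)) => //; rewrite ?addr_ge0 ?addr_gt0 ?ltW //.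
  move=> j h; rewrite ler_wpM2r ?ln_ge0 ?(ltW h) //.
  by rewrite lerDl ltW.
- apply: (@Ex_short_path m mb mc _ _ y2 (1 - eps)) => //; rewrite ?addr_ge0 ?subr_gt0 ?ltW //.
  move=> j h; rewrite ler_wnM2r ?(ltW h) // ln_le0 //.
  by rewrite gerBl ltW.
Qed.

End EventProb.

(** * Asymptotics *)

Section Asymptotics.
Variable R : realType.

Lemma exp_coeff_le_expR (x : R) j : 0 <= x -> x ^+ j / j`!%:R <= expR x.
Proof.
move=> x0; apply: le_trans (sum_exp_coeff_le j.+1 x0); rewrite big_ord_recr /= lerDr.
by apply: sumr_ge0 => i _; rewrite divr_ge0 // exprn_ge0.
Qed.

Lemma growth_ratio_le n k (K l : R) : 0 <= K -> 3 <= l -> n%:R = expR (2 * l) ->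
  k%:R <= l -> (k + 2 < n)%N /\ growth_ratio n k K <= expR ((24 * K + 18) * (l ^+ 2)^-1).
Proof.
move=> K0 l3 nE kl; have l0 : 0 < l by apply: lt_le_trans l3.
have n_ge : 2 / 3 * l ^+ 4 <= n%:R.
  have := @exp_coeff_le_expR (2 * l) 4; rewrite mulr_ge0 ?(ltW l0) // => /(_ isT).
  rewrite -nE; apply: le_trans; rewrite (_ : 4`! = 24)%N // exprMn.
  by rewrite le_eqVlt; apply/orP; left; apply/eqP; field.
have l4 : 27 * l <= l ^+ 4.
  have : 3 ^+ 3 <= l ^+ 3 by rewrite lerXn2r // nnegrE // ltW.
  rewrite (_ : 3 ^+ 3 = 27 :> R); last by ring.
  by rewrite (exprS _ 3) (mulrC 27) ler_pM2l.
have k2 : (k + 2)%:R <= 3 * l :> R by rewrite natrD; lra.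
have k1 : k.+1%:R <= 2 * l by rewrite -natr1; lra.
have nk2 : 2 * (k + 2)%:R <= n%:R :> R by move: n_ge l4 k2; lra.
have n0 : 0 < n%:R :> R by rewrite nE expR_gt0.
have kn : (k + 2 < n)%N.
  by rewrite -(ltr_nat R); have : 0 < (k + 2)%:R :> R by [rewrite ltr0n addn2]; move: nk2; lra.
split=> //; rewrite /growth_ratio.
have D0 : 0 < n%:R - (k + 2)%:R :> R by rewrite subr_gt0 ltr_nat.
pose h := (2 * K * k.+1%:R + (k + 2)%:R) / (n%:R - (k + 2)%:R).
have h0 : 0 <= h by rewrite divr_ge0 ?(ltW D0) // addr_ge0 // !mulr_ge0.
have -> : (n%:R + 2 * K * k.+1%:R) / (n%:R - (k + 2)%:R) = 1 + h.
  have aux (x y z : R) : x - z != 0 -> (x + y) / (x - z) = 1 + (y + z) / (x - z).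
    by move=> ?; field.
  by rewrite /h aux // gt_eqF.
apply: (@le_trans _ _ (expR h ^+ k.+1)).
  by rewrite lerXn2r ?nnegrE ?expR_ge0 ?addr_ge0 // expR_ge1Dx.
rewrite -expRM_natr ler_expR.
have hle : h <= (8 * K + 6) * l / (2 / 3 * l ^+ 4).
  rewrite /h.
  have d1 : n%:R / 2 <= n%:R - (k + 2)%:R :> R.
    have aux (x y : R) : 2 * y <= x -> x / 2 <= x - y by lra.
    exact: aux.
  apply: (@le_trans _ _ ((2 * K * k.+1%:R + (k + 2)%:R) / (n%:R / 2))).
    rewrite ler_wpM2l ?addr_ge0 ?mulr_ge0 // lef_pV2 ?posrE ?divr_gt0 //.
  rewrite invf_div mulrA ler_pM ?invr_ge0 ?mulr_ge0 ?addr_ge0 ?mulr_ge0 //.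
    have : K * k.+1%:R <= K * (2 * l) by rewrite ler_wpM2l.
    by move: k2; lra.
  by rewrite lef_pV2 ?posrE ?mulr_gt0 ?exprn_gt0.
apply: (@le_trans _ _ ((8 * K + 6) * l / (2 / 3 * l ^+ 4) * (2 * l))).
  by apply: ler_pM.
rewrite le_eqVlt; apply/orP; left; apply/eqP; field.
by rewrite gt_eqF.
Qed.

(* Here u stands for l^-2. *)
Definition psi (A B C D u : R) : R :=
  D * u + (expR (C * u) * (A * u) + (1 + u * B) ^+ 2 * expR (C * u) - 1).

Lemma psi_small (A B C D eta : R) : 0 < eta ->
  exists2 r : R, 0 < r & forall u : R, 0 <= u -> u < r -> psi A B C D u <= eta.
Proof.
move=> eta0.
have cp : (psi A B C D x @[x --> 0] --> psi A B C D 0)%classic.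
  rewrite /psi; apply: cvgD; first by apply: cvgM; [exact: cvg_cst|exact: cvg_id].
  have ce : (expR (C * x) @[x --> 0] --> expR (C * 0))%classic.
    apply: continuous_cvg; first exact: continuous_expR.
    by apply: cvgM; [exact: cvg_cst|exact: cvg_id].
  apply: cvgB; last exact: cvg_cst.
  apply: cvgD; apply: cvgM => //.
    by apply: cvgM; [exact: cvg_cst|exact: cvg_id].
  rewrite expr2; apply: cvgM; apply: cvgD; try exact: cvg_cst;
    by apply: cvgM; [exact: cvg_id|exact: cvg_cst].
have p0 : psi A B C D 0 = 0.
  by rewrite /psi !(mulr0, mul0r, addr0, add0r, expR0, expr1n, mulr1, subrr).
rewrite p0 in cp; have /cvgrPdist_le /(_ _ eta0) := cp.
move=> /nbhs_ballP[r /= r0 h]; exists r => // u u0 ur.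
have := h u; rewrite /ball /= sub0r normrN ger0_norm // => /(_ ur).
by rewrite sub0r normrN; apply: le_trans; exact: ler_norm.
Qed.

Lemma failure_bound_le n k (K l kappa delta : R) : 0 <= K -> 0 < kappa -> 0 < delta ->
  3 <= l -> n%:R = expR (2 * l) -> k%:R <= l ->
  failure_bound n delta K kappa k l <=
  psi (expR 4 / delta ^+ 4) (K / delta ^+ 2) (24 * K + 18) (3 / (2 * kappa ^+ 2)) (l ^+ 2)^-1.
Proof.
move=> K0 kappa0 delta0 l3 nE kl; have [_ gr] := growth_ratio_le K0 l3 nE kl.
have l0 : 0 < l by apply: lt_le_trans l3.
have l2 : 0 < l ^+ 2 by rewrite exprn_gt0.
rewrite /failure_bound /psi; set g := growth_ratio n k K in gr *.
apply: lerD.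
  have x0 : 0 < 2 * kappa * l by rewrite !mulr_gt0.
  have := exp_coeff_le_expR 2 (ltW x0); rewrite (_ : 2`! = 2)%N // => h.
  rewrite expRN; apply: (@le_trans _ _ (3 * ((2 * kappa * l) ^+ 2 / 2)^-1)).
    rewrite ler_wpM2l // lef_pV2 ?posrE ?expR_gt0 // divr_gt0 // exprn_gt0 //.
  rewrite le_eqVlt; apply/orP; left; apply/eqP; field.
  by rewrite !gt_eqF.
rewrite lerD2r; apply: lerD.
  rewrite [X in g * X](_ : _ = expR 4 / delta ^+ 4 * (l ^+ 2)^-1); last by rewrite invfM mulrA.
  by rewrite ler_wpM2r // !mulr_ge0 ?expR_ge0 ?invr_ge0 ?exprn_ge0 ?(ltW delta0) ?(ltW l0).
rewrite [X in (1 + X) ^+ 2 * g](_ : _ = (l ^+ 2)^-1 * (K / delta ^+ 2)); last first.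
  by rewrite exprMn invfM; ring.
by rewrite ler_wpM2l // sqr_ge0.
Qed.

End Asymptotics.

Lemma diagonal (R : realType) (q : R -> nat -> \bar R) :
  (forall e n, (q e n <= 1)%E) ->
  (forall e : R, 0 < e -> e < 1 -> \forall n \near \oo%classic, ((1 - e)%:E <= q e n)%E) ->
  exists2 eps : nat -> R, (eps n @[n --> \oo] --> (0 : R))%classic &
    (q (eps n) n @[n --> \oo] --> (1 : \bar R))%E%classic.
Proof.
move=> q1 qe.
pose e j : R := (j.+2%:R)^-1.
have e_gt0 j : 0 < e j by rewrite invr_gt0.
have e_lt1 j : e j < 1 by rewrite invf_lt1 // ltr1n.
have {}qe j : exists N, forall n, (N <= n)%N -> ((1 - e j)%:E <= q (e j) n)%E.
  by have [N _ h] := qe _ (e_gt0 j) (e_lt1 j); exists N => n; exact: h.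
have [N qN] := boolp.choice qe.
pose J n := (\max_(j < n.+1 | (N j <= n)%N) j)%N.
pose eps n := e (J n).
have J_ge j n : (j <= n)%N -> (N j <= n)%N -> (j <= J n)%N.
  move=> jn Njn; have jn' : (j < n.+1)%N by [].
  exact: (@leq_bigmax_cond _ (fun i : 'I_n.+1 => (N i <= n)%N) (fun i => nat_of_ord i) (Ordinal jn')).
have qJ n : (N 0 <= n)%N -> ((1 - eps n)%:E <= q (eps n) n)%E.
  move=> N0n; apply: qN.
  have [|i iN iE] := @eq_bigmax_cond _ [pred i : 'I_n.+1 | (N i <= n)%N] (fun i => nat_of_ord i).
    by apply/card_gt0P; exists ord0.
  by rewrite [J n]iE.
have eps_le (a : R) n : 0 < a -> (Num.truncn a^-1 <= J n)%N -> eps n <= a.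
  move=> a0 h; rewrite /eps /e invf_ple ?posrE //.
  have a1 : 0 <= a^-1 by rewrite invr_ge0 ltW.
  have /andP[_ /ltW h2] := truncn_itv a1; apply: le_trans h2 _.
  by rewrite ler_nat ltnW.
have eps0 : (eps n @[n --> \oo] --> (0 : R))%classic.
  apply/cvgrPdist_le => a a0; near=> n.
  rewrite sub0r normrN gtr0_norm; last exact: e_gt0.
  by apply: eps_le => //; apply: J_ge; near: n; exact: nbhs_infty_ge.
exists eps => //.
apply: (@squeeze_cvge _ _ _ _ (fun n => (1 - eps n)%:E) _ (fun=> 1%:E)).
- near=> n; rewrite q1 andbT qJ //.
  by near: n; exact: nbhs_infty_ge.
- have -> : (1 : \bar R)%E = (1 - 0)%:E by rewrite subr0.
  apply: cvg_EFin; first exact: nearW.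
  by apply: cvgB => //; exact: cvg_cst.
- exact: cvg_cst.
Unshelve. all: by end_near.
Qed.

(* A rate kappa and a slack delta that make both moment bounds work at
   precision eps. *)
Lemma constants_exist (R : realType) (eps : R) : 0 < eps -> eps < 1 ->
  exists kappa delta : R, [/\ 0 < kappa, 0 < delta, 256 * delta <= 1, 16 * delta <= eps &
  [/\ (1 - eps + delta) * (1 + delta) <= (1 - kappa) ^+ 2, kappa <= 1,
    (1 + 16 * delta + delta) * (1 + delta) <= (1 + kappa) ^+ 2,
    (1 + eps) * (1 + kappa - ln (1 + eps)) <= 1 - kappa &
    (1 - eps) * (1 + kappa - ln (1 - eps)) <= 1 - kappa]].
Proof.
move=> e0 e1.
have h1 : (1 + eps) * (1 - ln (1 + eps)) < 1.
  by apply: entropy_lt1; [rewrite addr_gt0|rewrite -subr_eq0 addrAC subrr add0r gt_eqF].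
have h2 : (1 - eps) * (1 - ln (1 - eps)) < 1.
  by apply: entropy_lt1; [rewrite subr_gt0|rewrite -subr_eq0 addrAC subrr add0r oppr_eq0 gt_eqF].
set g1 := (1 + eps) * (1 - _) in h1; set g2 := (1 - eps) * (1 - _) in h2.
have [g [g0 ge gg1 gg2]] : exists g, [/\ 0 < g, g <= eps, g <= 1 - g1 & g <= 1 - g2].
  exists (Num.min eps (Num.min (1 - g1) (1 - g2))).
  by rewrite !lt_min !ge_min !lexx ?orbT e0 !subr_gt0 h1 h2.
exists (g / 4), (g / 256).
split; [by rewrite divr_gt0|by rewrite divr_gt0|lra|lra|].
split; try (by nra).
- rewrite (_ : (1 + eps) * _ = g1 + (1 + eps) * (g / 4)); last by rewrite /g1; ring.
  nra.
- rewrite (_ : (1 - eps) * _ = g2 + (1 - eps) * (g / 4)); last by rewrite /g2; ring.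
  nra.
Qed.

Unset Implicit Arguments.

Section FixedPrecision.
Variables (R : realType) (d : nat -> measure_display) (T : forall n : nat, measurableType (d n)).
Variables (P : forall n : nat, probability (T n) R) (w c : forall n : nat, edge n -> {RV (P n) >-> R}).
Variable c0 : nat -> R.
Hypothesis w_unif : forall (n : nat) (e : edge n), uniform01 (w n e).
Hypothesis c_unif : forall (n : nat) (e : edge n), uniform01 (c n e).
Hypothesis wc_indep : forall n : nat, mutually_independent (join_edges (w n) (c n)).
Hypothesis c0_bounds : \forall n \near \oo%classic,
     1 / Num.sqrt 2 * (ln (n%:R : R) ^+ 2 / n%:R) <= c0 n
     /\ c0 n <= 1 / (2 * Num.sqrt 2).

Definition close_event (eps : R) (n : nat) : set (T n) := [set omega : T n |
      rel_close eps
        (min_length (fun e => w n e omega) (fun e => c n e omega) (c0 n))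
        (ln (n%:R : R) ^+ 2 / (4 * c0 n * n%:R))
      /\ forall p : {bseq n of 'I_n},
        optimal (fun e => w n e omega) (fun e => c n e omega) (c0 n) p ->
        rel_close eps (#|path_edges p|%:R%:E) (ln (n%:R : R) / 2)]%classic.

Lemma prob_close_event (eps eta : R) : 0 < eps -> eps < 1 -> 0 < eta ->
  \forall n \near \oo%classic, ((1 - eta)%:E <= P n (close_event eps n))%E.
Proof.
move=> e0 e1 eta0.
have [kappa [delta [kappa0 delta0 d256 d16 [y1s kappa1 y2s hi lo]]]] := constants_exist e0 e1.
pose x := (1 - 4 * delta) ^+ 2 * (1 + 16 * delta).
have x1 : 1 < x by rewrite /x; nra.
have x0 : 0 < x by apply: lt_trans x1.
pose rho := x^-1; pose K := (1 - rho)^-1.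
have rho0 : 0 < rho by rewrite invr_gt0.
have rho1 : rho < 1 by rewrite invf_lt1.
have K0 : 0 <= K by rewrite invr_ge0 subr_ge0 ltW.
have rhoK : 1 + rho * K <= K.
  by rewrite -lerBrDr -{1}[K]mul1r -mulrBl mulfV // gt_eqF // subr_gt0.
have [r r0 psi_le] := psi_small (expR 4 / delta ^+ 4) (K / delta ^+ 2) (24 * K + 18)
  (3 / (2 * kappa ^+ 2)) eta0.
near=> n.
have [c0_lo c0_hi] : 1 / Num.sqrt 2 * (ln (n%:R : R) ^+ 2 / n%:R) <= c0 n
     /\ c0 n <= 1 / (2 * Num.sqrt 2) by near: n.
pose l : R := ln n%:R / 2.
have n_big : expR (2 * (3 + r^-1)) <= n%:R by near: n; exact: nbhs_infty_ger.
have n0 : 0 < n%:R :> R by apply: lt_le_trans n_big; exact: expR_gt0.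
have nE : n%:R = expR (2 * l).
  by rewrite /l mulrCA divff // mulr1 lnK.
have l_ge : 3 + r^-1 <= l.
  by move: n_big; rewrite nE ler_expR ler_pM2l.
have ri : 0 < r^-1 by rewrite invr_gt0.
have l3 : 3 <= l by move: l_ge ri; lra.
have l0 : 0 < l by apply: lt_le_trans l3.
pose k := Num.truncn l.
have /andP[kl /ltW lk] := truncn_itv (ltW l0).
have k0 : (0 < k)%N by rewrite truncn_gt0; move: l3; lra.
have [kn _] := growth_ratio_le K0 l3 nE kl.
have n2 : (1 < n)%N by apply: leq_ltn_trans kn; rewrite addn2.
have sq0 : 0 < Num.sqrt 2 :> R by rewrite sqrtr_gt0.
have sq2 : Num.sqrt 2 ^+ 2 = 2 :> R by rewrite sqr_sqrtr.
pose X : R := ln n%:R ^+ 2 / n%:R.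
have lnn : ln n%:R = 2 * l :> R by rewrite /l mulrCA divff // mulr1.
have X0 : 0 < X by rewrite /X lnn divr_gt0 // exprn_gt0 // mulr_gt0.
have c00 : 0 < c0 n by apply: lt_le_trans c0_lo; rewrite mulr_gt0 // divr_gt0.
have X_le : X <= Num.sqrt 2 * c0 n by rewrite -ler_pdivrMl // mulrC -[_^-1]mul1r mulrC.
have sq_le2 : Num.sqrt 2 <= 2 :> R by move: sq2 sq0; nra.
have sq_ge1 : 1 <= Num.sqrt 2 :> R by move: sq2 sq0; nra.
pose b : R := ln n%:R ^+ 2 / (4 * c0 n * n%:R).
have bE : b = X / (4 * c0 n) by rewrite /b /X; field; rewrite !gt_eqF.
have b0 : 0 < b by rewrite bE divr_gt0 // mulr_gt0.
have b_le : b <= 1 / 2.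
  rewrite bE ler_pdivrMr ?mulr_gt0 //; apply: le_trans X_le _.
  by move: sq_le2 c00; nra.
have c01 : c0 n <= 1.
  apply: le_trans c0_hi _; rewrite ler_pdivrMr ?mulr_gt0 // mul1r.
  by move: sq_ge1; lra.
have bc : n%:R * (b * c0 n) = l ^+ 2.
  by rewrite /b lnn; field; rewrite !gt_eqF.
apply: le_trans (@event_prob_ge _ (T n) R (P n) n n2 (w n) (c n) (w_unif n) (c_unif n)
  (wc_indep n) eps (16 * delta) delta delta rho K kappa (1 - kappa) (1 + kappa)
  e0 e1 _ d16 delta0 (lexx _) _ (ltW rho0) (ltW rho1) K0 rhoK _ _ _ (lexx _) y1s y2s
  hi lo k l b (c0 n) k0 kn l0 nE kl lk b0 c00 bc _ c01).
- rewrite lee_fin lerD2l lerN2; apply: le_trans (failure_bound_le K0 kappa0 delta0 l3 nE kl) _.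
  apply: psi_le; first by rewrite invr_ge0 sqr_ge0.
  rewrite -[ltRHS]invrK ltf_pV2 ?posrE ?exprn_gt0 ?invr_gt0 //.
  by move: l_ge ri; nra.
- by rewrite mulr_gt0.
- by move: d256 delta0; lra.
- by rewrite -/x mulVf // gt_eqF.
- by rewrite subr_ge0.
- by rewrite addr_ge0 // ltW.
- by move: b_le d256 b0 delta0; nra.
Unshelve. all: by end_near.
Qed.

End FixedPrecision.

Local Open Scope classical_set_scope.

Theorem theorem1 (R : realType)
  (d : nat -> measure_display) (T : forall n : nat, measurableType (d n))
  (P : forall n : nat, probability (T n) R)
  (w c : forall n : nat, edge n -> {RV (P n) >-> R})
  (c0 : nat -> R)
  (w_unif : forall (n : nat) (e : edge n), uniform01 (w n e))
  (c_unif : forall (n : nat) (e : edge n), uniform01 (c n e))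
  (wc_indep : forall n : nat, mutually_independent (join_edges (w n) (c n)))
  (c0_bounds : \forall n \near \oo,
     1 / Num.sqrt 2 * (ln (n%:R : R) ^+ 2 / n%:R) <= c0 n
     /\ c0 n <= 1 / (2 * Num.sqrt 2)) :
  exists2 eps : nat -> R, eps n @[n --> \oo] --> (0 : R) &
    P n [set omega : T n |
      rel_close (eps n)
        (min_length (fun e => w n e omega) (fun e => c n e omega) (c0 n))
        (ln (n%:R : R) ^+ 2 / (4 * c0 n * n%:R))
      /\ forall p : {bseq n of 'I_n},
        optimal (fun e => w n e omega) (fun e => c n e omega) (c0 n) p ->
        rel_close (eps n) (#|path_edges p|%:R%:E) (ln (n%:R : R) / 2)]
    @[n --> \oo] --> (1 : \bar R)%E.
Proof.
apply: (@diagonal R (fun e n => P n (close_event R d T P w c c0 e n))).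
  by move=> e n; apply: probability_le1; exact: measurable_close_event.
by move=> e e0 e1; exact: prob_close_event.
Qed.
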